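(* Suppose $[(\mathcal{X},\omega);(\nu,\mathcal{Y})]$ is a strong finite balanced system in an abelian category $\mathcal{A}$ with enough projective and injective objects, such that $\mathcal{X}$ and $\mathcal{Y}$ are closed under direct summands, and $\omega$ and $\nu$ are closed under finite coproducts. Then $[(\mathsf{Ch}(\mathcal{X}),\widetilde{\omega});(\widetilde{\nu},\mathsf{Ch}(\mathcal{Y}))]$ is a strong finite balanced system in $\mathsf{Ch}(\mathcal{A})$. Furthermore, $(\mathsf{Ch}(\mathcal{X}),\mathsf{Ch}(\mathcal{Y}))$ is a balanced pair with respect to $(\mathsf{Ch}(\mathcal{X})^\wedge,\mathsf{Ch}(\mathcal{Y})^\vee)$.
   Context: Classes of objects are closed under isomorphisms. In an abelian category $\mathcal{B}$ (below, $\mathcal{B}=\mathcal{A}$ or $\mathcal{B}=\mathsf{Ch}(\mathcal{A})$), $\mathrm{Ext}^n_{\mathcal{B}}$ denotes Yoneda Ext and $\mathrm{Ext}^n_{\mathcal{B}}(\mathcal{C},\mathcal{D})=0$ means $\mathrm{Ext}^n_{\mathcal{B}}(C,D)=0$ for all $C\in\mathcal{C}$, $D\in\mathcal{D}$. A class is pointed if it contains $0$. $\mathrm{id}_{\mathcal{C}}(\mathcal{D})=0$ means $\mathrm{Ext}^i_{\mathcal{B}}(\mathcal{C},\mathcal{D})=0$ for all $i\ge1$; $\mathrm{pd}_{\mathcal{C}}(\mathcal{D})=0$ means $\mathrm{Ext}^i_{\mathcal{B}}(\mathcal{D},\mathcal{C})=0$ for all $i\ge1$. Complexes. $\mathsf{Ch}(\mathcal{A})$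 is the abelian category of ($\mathbb{Z}$-graded, unbounded) chain complexes over $\mathcal{A}$. For a class $\mathcal{C}\subseteq\mathcal{A}$, $\mathsf{Ch}(\mathcal{C})$ is the class of complexes $X_\bullet$ with $X_m\in\mathcal{C}$ for all $m\in\mathbb{Z}$, and $\widetilde{\mathcal{C}}$ is the class of exact complexes $X_\bullet$ with all cycles $Z_m(X_\bullet)\in\mathcal{C}$, $m\in\mathbb{Z}$. $\omega$ is a relative cogenerator in $\mathcal{X}$ if $\omega\subseteq\mathcal{X}$ and for every $X\in\mathcal{X}$ there is a short exact sequence $0\to X\to W\to X'\to0$ with $W\in\omega$, $X'\in\mathcal{X}$. $\nu$ is a relative generator in $\mathcal{Y}$ if $\nu\subseteq\mathcal{Y}$ and for every $Y\in\mathcal{Y}$ there is a short exact sequence $0\to Y'\to V\to Y\to0$ with $V\in\nu$, $Y'\in\mathcal{Y}$. $\mathcal{C}^\wedge$ is the class of objects $M$ admitting an exact sequence $0\to C_n\to\cdots\to C_0\to M\to0$ with $n\in\mathbb{N}$ and all $C_k\in\mathcal{C}$; $\mathcal{C}^\vee$ is the class of objects $N$ admitting an exact sequence $0\to N\to C^0\to\cdots\to C^n\to0$ with $n\in\mathbb{N}$ and all $C^k\in\mathcal{C}$. Finite balanced system (in $\mathcal{B}$). $[(\mathcal{X},\omega);(\nu,\mathcal{Y})]$ is a finite balanced system if: (fbs1) $\mathcal{X}$ is pointed and closed under extensions; (fbs2) $\mathcal{Y}$ is pointed and closed under extensions; (fbs3) $\omega$ is a relative cogenerator in $\mathcal{X}$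 with $\mathrm{id}_{\mathcal{X}}(\omega)=0$; (fbs4) $\nu$ is a relative generator in $\mathcal{Y}$ with $\mathrm{pd}_{\mathcal{Y}}(\nu)=0$; (fbs5) $\mathrm{Ext}^1_{\mathcal{B}}(\mathcal{X}^\wedge,\nu)=\mathrm{Ext}^1_{\mathcal{B}}(\omega^\wedge,\mathcal{Y})=0$; (fbs6) $\mathrm{Ext}^1_{\mathcal{B}}(\omega,\mathcal{Y}^\vee)=\mathrm{Ext}^1_{\mathcal{B}}(\mathcal{X},\nu^\vee)=0$. It is strong if in addition $\mathrm{pd}_{\mathcal{Y}}(\omega)=0$ and $\mathrm{id}_{\mathcal{X}}(\nu)=0$. Resolutions. A left $\mathcal{X}$-resolution of $M$ is a (not necessarily exact) complex $\cdots\to X_1\to X_0\to M\to0$ with all $X_k\in\mathcal{X}$; it is proper if it becomes exact after applying $\mathrm{Hom}_{\mathcal{B}}(X,-)$ for every $X\in\mathcal{X}$. A right $\mathcal{Y}$-resolution of $N$ is a (not necessarily exact) complex $0\to N\to Y^0\to Y^1\to\cdots$ with all $Y^k\in\mathcal{Y}$; it is proper if it becomes exact after applying $\mathrm{Hom}_{\mathcal{B}}(-,Y)$ for every $Y\in\mathcal{Y}$. $\mathsf{p.l.res}(\mathcal{X})$ (resp. $\mathsf{p.r.res}(\mathcal{Y})$) is the class of objects admitting a proper left $\mathcal{X}$-resolution (resp. proper right $\mathcal{Y}$-resolution). A complex is $\mathrm{Hom}_{\mathcal{B}}(\mathcal{X},-)$-acyclic (resp. $\mathrm{Hom}_{\mathcal{B}}(-,\mathcal{Y})$-acyclic)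 if it becomes exact after applying $\mathrm{Hom}_{\mathcal{B}}(X,-)$ for every $X\in\mathcal{X}$ (resp. $\mathrm{Hom}_{\mathcal{B}}(-,Y)$ for every $Y\in\mathcal{Y}$). Balanced pair. $(\mathcal{X},\mathcal{Y})$ is a balanced pair with respect to $(\tilde{\mathcal{X}},\tilde{\mathcal{Y}})$ if: $\mathcal{X}\subseteq\tilde{\mathcal{X}}\subseteq\mathsf{p.l.res}(\mathcal{X})$ and $\mathcal{Y}\subseteq\tilde{\mathcal{Y}}\subseteq\mathsf{p.r.res}(\mathcal{Y})$; every $M\in\tilde{\mathcal{X}}$ has a $\mathrm{Hom}_{\mathcal{B}}(-,\mathcal{Y})$-acyclic proper left $\mathcal{X}$-resolution; every $N\in\tilde{\mathcal{Y}}$ has a $\mathrm{Hom}_{\mathcal{B}}(\mathcal{X},-)$-acyclic proper right $\mathcal{Y}$-resolution. *)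

(* Defs.v *)
From HB Require Import structures.
From mathcomp Require Import all_boot all_order all_algebra.
From mathcomp Require Import boolp.
From Stdlib Require Import Relations.

Set Implicit Arguments.
Unset Strict Implicit.
Unset Printing Implicit Defensive.

Import GRing.Theory.
Local Open Scope ring_scope.

Record preadditive := Preadditive {
  obj :> Type;
  hom : obj -> obj -> zmodType;
  idm : forall x, hom x x;
  compm : forall x y z, hom y z -> hom x y -> hom x z;
  compm1 : forall x y (f : hom x y), compm f (idm x) = f;
  comp1m : forall x y (f : hom x y), compm (idm y) f = f;
  compmA : forall x y z t (h : hom z t) (g : hom y z) (f : hom x y),
    compm h (compm g f) = compm (compm h g) f;
  compmDl : forall x y z (g g' : hom y z) (f : hom x y),
    compm (g + g') f = compm g f + compm g' f;
  compmDr : forall x y z (g : hom y z) (f f' : hom x y),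
    compm g (f + f') = compm g f + compm g f'
}.
Arguments hom {_} _ _.
Arguments idm {_} _.
Arguments compm {_ _ _ _} _ _.

Reserved Notation "g \co f" (at level 40, left associativity).
Notation "g \co f" := (compm g f) : ring_scope.

(* The notions below are the usual ones of abelian category theory; they only
   refer to the underlying preadditive structure, and are meant for categories
   satisfying the predicate [abelian], such as [Ch A] for A abelian (lemma
   [ch_abelian]). *)
Section Notions.
Variable B : preadditive.
Implicit Types (x y z w s : B) (C D : B -> Prop).

Definition monic x y (f : hom x y) : Prop :=
  forall w (g h : hom w x), f \co g = f \co h -> g = h.

Definition epic x y (f : hom x y) : Prop :=
  forall w (g h : hom y w), g \co f = h \co f -> g = h.

Definition is_iso x y (f : hom x y) : Prop :=
  exists g : hom y x, g \co f = idm x /\ f \co g = idm y.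

Definition is_zero z : Prop :=
  (forall x (f : hom x z), f = 0) /\ (forall x (f : hom z x), f = 0).

Definition is_kernel k x y (i : hom k x) (f : hom x y) : Prop :=
  f \co i = 0 /\
  forall w (g : hom w x), f \co g = 0 -> exists! h : hom w k, i \co h = g.

Definition is_cokernel x y c (p : hom y c) (f : hom x y) : Prop :=
  p \co f = 0 /\
  forall w (g : hom y w), g \co f = 0 -> exists! h : hom c w, h \co p = g.

Definition is_coproduct (n : nat) (x : 'I_n -> B) s
    (i : forall j, hom (x j) s) : Prop :=
  forall w (f : forall j, hom (x j) w),
    exists! h : hom s w, forall j, h \co i j = f j.

Definition is_biproduct x y s (i1 : hom x s) (i2 : hom y s)
    (p1 : hom s x) (p2 : hom s y) : Prop :=
  [/\ p1 \co i1 = idm x, p2 \co i2 = idm y, p2 \co i1 = 0, p1 \co i2 = 0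
    & i1 \co p1 + i2 \co p2 = idm s].

Record abelian : Prop := Abelian {
  abelian_zero : exists z, is_zero z;
  abelian_biproduct : forall x y, exists s (i1 : hom x s) (i2 : hom y s)
    (p1 : hom s x) (p2 : hom s y), is_biproduct i1 i2 p1 p2;
  abelian_kernel : forall x y (f : hom x y),
    exists k (i : hom k x), is_kernel i f;
  abelian_cokernel : forall x y (f : hom x y),
    exists c (p : hom y c), is_cokernel p f;
  abelian_monic : forall x y (f : hom x y), monic f ->
    exists z (g : hom y z), is_kernel f g;
  abelian_epic : forall x y (f : hom x y), epic f ->
    exists z (g : hom z x), is_cokernel f g
}.

Definition projective p : Prop :=
  forall x y (e : hom x y) (f : hom p y), epic e ->
    exists g : hom p x, e \co g = f.

Definition injective_obj i : Prop :=
  forall x y (m : hom x y) (f : hom x i), monic m ->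
    exists g : hom y i, g \co m = f.

Definition enough_projectives : Prop :=
  forall x, exists p (e : hom p x), projective p /\ epic e.

Definition enough_injectives : Prop :=
  forall x, exists i (m : hom x i), injective_obj i /\ monic m.

(* The image is the kernel of the cokernel. *)
Definition is_image k x y (i : hom k y) (f : hom x y) : Prop :=
  exists c (p : hom y c), is_cokernel p f /\ is_kernel i p.

(* x -f-> y -g-> z is exact at y *)
Definition exact_at x y z (f : hom x y) (g : hom y z) : Prop :=
  exists k (i : hom k y), is_image i f /\ is_kernel i g.

(* 0 -> x -> y -> z -> 0 *)
Definition short_exact x y z (f : hom x y) (g : hom y z) : Prop :=
  [/\ monic f, exact_at f g & epic g].

Definition subclass C D : Prop := forall x, C x -> D x.

Definition iso_closed C : Prop :=
  forall x y (f : hom x y), is_iso f -> C x -> C y.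

Definition pointed C : Prop := exists z, is_zero z /\ C z.

Definition extension_closed C : Prop :=
  forall x y z (f : hom x y) (g : hom y z),
    short_exact f g -> C x -> C z -> C y.

Definition summand_closed C : Prop :=
  forall x y s (i1 : hom x s) (i2 : hom y s) (p1 : hom s x) (p2 : hom s y),
    is_biproduct i1 i2 p1 p2 -> C s -> C x.

(* The empty coproduct, n = 0, is included. *)
Definition fin_coproduct_closed C : Prop :=
  forall n (x : 'I_n -> B) s (i : forall j, hom (x j) s),
    is_coproduct i -> (forall j, C (x j)) -> C s.

Definition rel_cogenerator (W X : B -> Prop) : Prop :=
  subclass W X /\
  forall x, X x -> exists w x' (f : hom x w) (g : hom w x'),
    [/\ short_exact f g, W w & X x'].

Definition rel_generator (V Y : B -> Prop) : Prop :=
  subclass V Y /\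
  forall y, Y y -> exists v y' (f : hom y' v) (g : hom v y),
    [/\ short_exact f g, V v & Y y'].

(* ... -> E_1 -> E_0 -> x *)
Record lseq x := LSeq {
  lterm :> nat -> B;
  lbd : forall k, hom (lterm k.+1) (lterm k);
  laug : hom (lterm 0%N) x
}.

(* x -> E^0 -> E^1 -> ... *)
Record rseq x := RSeq {
  rterm :> nat -> B;
  rbd : forall k, hom (rterm k) (rterm k.+1);
  raug : hom x (rterm 0%N)
}.

(* The map leaving E_k: the augmentation if k = 0, otherwise E_k -> E_(k-1). *)
Definition lnext x (E : lseq x) (k : nat) : B :=
  if k is k'.+1 then E k' else x.

Definition lout x (E : lseq x) (k : nat) : hom (E k) (lnext E k) :=
  match k with 0 => laug E | k'.+1 => lbd E k' end.

(* The map entering E^k: the augmentation if k = 0, otherwise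
   E^(k-1) -> E^k. *)
Definition rprev x (E : rseq x) (k : nat) : B :=
  if k is k'.+1 then E k' else x.

Definition rin x (E : rseq x) (k : nat) : hom (rprev E k) (E k) :=
  match k with 0 => raug E | k'.+1 => rbd E k' end.

(* Finite exact sequences are initial parts of an [lseq] or [rseq]; what lies
   beyond is irrelevant.
   [lexact E n]: E_n -> ... -> E_0 -> x -> 0 is exact, except at E_n. *)
Definition lexact x (E : lseq x) (n : nat) : Prop :=
  epic (laug E) /\ forall k, (k < n)%N -> exact_at (lbd E k) (lout E k).

(* [rexact E n]: 0 -> x -> E^0 -> ... -> E^n is exact, except at E^n. *)
Definition rexact x (E : rseq x) (n : nat) : Prop :=
  monic (raug E) /\ forall k, (k < n)%N -> exact_at (rin E k) (rbd E k).

(* C^wedge: 0 -> C_n -> ... -> C_0 -> x -> 0 exact *)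
Definition wedge C x : Prop :=
  exists (E : lseq x) (n : nat),
    [/\ forall k, (k <= n)%N -> C (E k), lexact E n & monic (lout E n)].

(* C^vee: 0 -> x -> C^0 -> ... -> C^n -> 0 exact *)
Definition vee C x : Prop :=
  exists (E : rseq x) (n : nat),
    [/\ forall k, (k <= n)%N -> C (E k), rexact E n & epic (rin E n)].

(* Yoneda extensions of length n.+1:
   0 -> y -> E_n -> ... -> E_0 -> x -> 0 exact *)
Record yext (n : nat) x y := YExt {
  yseq :> lseq x;
  yinj : hom y (yseq n);
  yexact : lexact yseq n;
  yinj_monic : monic yinj;
  yinj_exact : exact_at yinj (lout yseq n)
}.

Definition yext_map n x y (E F : yext n x y) : Prop :=
  exists f : forall k, hom (E k) (F k),
    [/\ laug F \co f 0%N = laug E,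
        forall k, (k < n)%N -> lbd F k \co f k.+1 = f k \co lbd E k
      & f n \co yinj E = yinj F].

(* Elements of Ext^(n+1)(x,y) are Yoneda extensions modulo this relation. *)
Definition yext_equiv n x y (E F : yext n x y) : Prop :=
  clos_refl_sym_trans (yext n x y) (@yext_map n x y) E F.

(* Ext^i(x,y) = 0, for i >= 1: the group is trivial iff it has at most one
   element. *)
Definition ext_zero (i : nat) x y : Prop :=
  forall E F : yext i.-1 x y, yext_equiv E F.

Definition Ext_zero (i : nat) C D : Prop :=
  forall x y, C x -> D y -> ext_zero i x y.

Definition id_zero C D : Prop := forall i, (1 <= i)%N -> Ext_zero i C D.

Definition pd_zero C D : Prop := forall i, (1 <= i)%N -> Ext_zero i D C.

Record finite_balanced_system (X W V Y : B -> Prop) : Prop := FBS {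
  fbs1 : pointed X /\ extension_closed X;
  fbs2 : pointed Y /\ extension_closed Y;
  fbs3 : rel_cogenerator W X /\ id_zero X W;
  fbs4 : rel_generator V Y /\ pd_zero Y V;
  fbs5 : Ext_zero 1 (wedge X) V /\ Ext_zero 1 (wedge W) Y;
  fbs6 : Ext_zero 1 W (vee Y) /\ Ext_zero 1 X (vee V)
}.

Definition strong_finite_balanced_system (X W V Y : B -> Prop) : Prop :=
  [/\ finite_balanced_system X W V Y, pd_zero Y W & id_zero X V].

(* Exactness of U -f-> V -g-> W for abelian groups *)
Definition exact_ab (U V W : zmodType) (f : U -> V) (g : V -> W) : Prop :=
  forall v, g v = 0 <-> exists u, f u = v.

Definition left_resolution X x (E : lseq x) : Prop :=
  (forall k, lout E k \co lbd E k = 0) /\ (forall k, X (E k)).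

Definition right_resolution Y x (E : rseq x) : Prop :=
  (forall k, rbd E k \co rin E k = 0) /\ (forall k, Y (E k)).

(* Hom(w, -) turns ... -> E_1 -> E_0 -> x -> 0 into an exact sequence, etc. *)
Definition lseq_cov_acyclic X x (E : lseq x) : Prop :=
  forall w, X w ->
    (forall f : hom w x, exists g : hom w (E 0%N), laug E \co g = f) /\
    (forall k, exact_ab (fun h : hom w (E k.+1) => lbd E k \co h)
                        (fun h : hom w (E k) => lout E k \co h)).

Definition lseq_contra_acyclic Y x (E : lseq x) : Prop :=
  forall w, Y w ->
    (forall f : hom x w, f \co laug E = 0 -> f = 0) /\
    (forall k, exact_ab (fun h : hom (lnext E k) w => h \co lout E k)
                        (fun h : hom (E k) w => h \co lbd E k)).

Definition rseq_contra_acyclic Y x (E : rseq x) : Prop :=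
  forall w, Y w ->
    (forall f : hom x w, exists g : hom (E 0%N) w, g \co raug E = f) /\
    (forall k, exact_ab (fun h : hom (E k.+1) w => h \co rbd E k)
                        (fun h : hom (E k) w => h \co rin E k)).

Definition rseq_cov_acyclic X x (E : rseq x) : Prop :=
  forall w, X w ->
    (forall f : hom w x, raug E \co f = 0 -> f = 0) /\
    (forall k, exact_ab (fun h : hom w (rprev E k) => rin E k \co h)
                        (fun h : hom w (E k) => rbd E k \co h)).

Definition proper_left_resolution X x (E : lseq x) : Prop :=
  left_resolution X E /\ lseq_cov_acyclic X E.

Definition proper_right_resolution Y x (E : rseq x) : Prop :=
  right_resolution Y E /\ rseq_contra_acyclic Y E.

Definition plres X x : Prop := exists E : lseq x, proper_left_resolution X E.

Definition prres Y x : Prop := exists E : rseq x, proper_right_resolution Y E.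

Record balanced_pair (X Y X' Y' : B -> Prop) : Prop := BalancedPair {
  bp_left : subclass X X' /\ subclass X' (plres X);
  bp_right : subclass Y Y' /\ subclass Y' (prres Y);
  bp_left_acyclic : forall x, X' x -> exists E : lseq x,
    proper_left_resolution X E /\ lseq_contra_acyclic Y E;
  bp_right_acyclic : forall y, Y' y -> exists E : rseq y,
    proper_right_resolution Y E /\ rseq_cov_acyclic X E
}.

End Notions.

Section ComposeTheory.
Variable B : preadditive.
Implicit Types x y z : B.

Lemma comp0m x y z (f : hom x y) : (0 : hom y z) \co f = 0.
Proof. by apply: (addrI (0 \co f)); rewrite -compmDl !addr0. Qed.

Lemma compm0 x y z (g : hom y z) : g \co (0 : hom x y) = 0.
Proof. by apply: (addrI (g \co 0)); rewrite -compmDr !addr0. Qed.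

Lemma compNm x y z (g : hom y z) (f : hom x y) : (- g) \co f = - (g \co f).
Proof. by apply: (addrI (g \co f)); rewrite -compmDl !subrr comp0m. Qed.

Lemma compmN x y z (g : hom y z) (f : hom x y) : g \co (- f) = - (g \co f).
Proof. by apply: (addrI (g \co f)); rewrite -compmDr !subrr compm0. Qed.

End ComposeTheory.

(* Unbounded chain complexes.  The differential X_m -> X_(m-1) is
   [cdiff m (m - 1)]; it is indexed by its source and target degrees, and set
   to 0 unless source = target + 1, so that consecutive differentials compose
   without casts. *)
Record complex (A : preadditive) := Complex {
  cterm :> int -> A;
  cdiff : forall i j, hom (cterm i) (cterm j);
  cdiff_shape : forall i j, i != j + 1 -> cdiff i j = 0;
  cdiff_cdiff : forall i j k, cdiff j k \co cdiff i j = 0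
}.
Arguments cdiff {_} _ _ _.

Record chain_map (A : preadditive) (X Y : complex A) := ChainMap {
  cmap :> forall i, hom (X i) (Y i);
  cmap_comm : forall i j, cdiff Y i j \co cmap i = cmap j \co cdiff X i j
}.

Section ChainMaps.
Variable A : preadditive.
Implicit Types X Y Z T : complex A.

Lemma chain_mapP X Y (f g : chain_map X Y) : (forall i, f i = g i) -> f = g.
Proof.
case: f g => [f fP] [g gP] /= fg.
have {}fg : f = g by apply: functional_extensionality_dep.
by case: _ / fg gP => gP; rewrite (Prop_irrelevance fP gP).
Qed.

Lemma cmap0_subproof X Y i j :
  cdiff Y i j \co (0 : hom (X i) (Y i)) = 0 \co cdiff X i j.
Proof. by rewrite comp0m compm0. Qed.
Definition cmap0 X Y := ChainMap (@cmap0_subproof X Y).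

Lemma cmapN_subproof X Y (f : chain_map X Y) i j :
  cdiff Y i j \co (- f i) = (- f j) \co cdiff X i j.
Proof. by rewrite compNm compmN cmap_comm. Qed.
Definition cmapN X Y (f : chain_map X Y) := ChainMap (cmapN_subproof f).

Lemma cmapD_subproof X Y (f g : chain_map X Y) i j :
  cdiff Y i j \co (f i + g i) = (f j + g j) \co cdiff X i j.
Proof. by rewrite compmDl compmDr !cmap_comm. Qed.
Definition cmapD X Y (f g : chain_map X Y) := ChainMap (cmapD_subproof f g).

Lemma cmap_id_subproof X i j :
  cdiff X i j \co idm (X i) = idm (X j) \co cdiff X i j.
Proof. by rewrite compm1 comp1m. Qed.
Definition cmap_id X := ChainMap (@cmap_id_subproof X).

Lemma cmap_comp_subproof X Y Z (g : chain_map Y Z) (f : chain_map X Y) i j :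
  cdiff Z i j \co (g i \co f i) = (g j \co f j) \co cdiff X i j.
Proof. by rewrite compmA cmap_comm -compmA cmap_comm compmA. Qed.
Definition cmap_comp X Y Z (g : chain_map Y Z) (f : chain_map X Y) :=
  ChainMap (cmap_comp_subproof g f).

HB.instance Definition _ X Y := gen_eqMixin (chain_map X Y).
HB.instance Definition _ X Y := gen_choiceMixin (chain_map X Y).

Lemma cmapDA X Y : associative (@cmapD X Y).
Proof. by move=> f g h; apply: chain_mapP => i; exact: addrA. Qed.
Lemma cmapDC X Y : commutative (@cmapD X Y).
Proof. by move=> f g; apply: chain_mapP => i; exact: addrC. Qed.
Lemma cmap0D X Y : left_id (cmap0 X Y) (@cmapD X Y).
Proof. by move=> f; apply: chain_mapP => i; exact: add0r. Qed.
Lemma cmapND X Y : left_inverse (cmap0 X Y) (@cmapN X Y) (@cmapD X Y).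
Proof. by move=> f; apply: chain_mapP => i; exact: addNr. Qed.

HB.instance Definition _ X Y := GRing.isZmodule.Build (chain_map X Y)
  (@cmapDA X Y) (@cmapDC X Y) (@cmap0D X Y) (@cmapND X Y).

Lemma cmap_comp1 X Y (f : chain_map X Y) : cmap_comp f (cmap_id X) = f.
Proof. by apply: chain_mapP => i; exact: compm1. Qed.
Lemma cmap_1comp X Y (f : chain_map X Y) : cmap_comp (cmap_id Y) f = f.
Proof. by apply: chain_mapP => i; exact: comp1m. Qed.
Lemma cmap_compA X Y Z T (h : chain_map Z T) (g : chain_map Y Z)
    (f : chain_map X Y) :
  cmap_comp h (cmap_comp g f) = cmap_comp (cmap_comp h g) f.
Proof. by apply: chain_mapP => i; exact: compmA. Qed.
Lemma cmap_compDl X Y Z (g g' : chain_map Y Z) (f : chain_map X Y) :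
  cmap_comp (g + g') f = cmap_comp g f + cmap_comp g' f.
Proof. by apply: chain_mapP => i; exact: compmDl. Qed.
Lemma cmap_compDr X Y Z (g : chain_map Y Z) (f f' : chain_map X Y) :
  cmap_comp g (f + f') = cmap_comp g f + cmap_comp g f'.
Proof. by apply: chain_mapP => i; exact: compmDr. Qed.

End ChainMaps.

Definition Ch (A : preadditive) : preadditive :=
  @Preadditive (complex A) (fun X Y => chain_map X Y : zmodType)
    (@cmap_id A) (@cmap_comp A) (@cmap_comp1 A) (@cmap_1comp A)
    (@cmap_compA A) (@cmap_compDl A) (@cmap_compDr A).

Section ComplexClasses.
Variables (A : preadditive) (C : A -> Prop).

Definition ChC (X : Ch A) : Prop := forall m : int, C (cterm X m).

(* k is the object of cycles Z_m(X). *)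
Definition is_cycles (X : Ch A) (m : int) (k : A) : Prop :=
  exists i : hom k (cterm X m), is_kernel i (cdiff X m (m - 1)).

Definition exact_complex (X : Ch A) : Prop :=
  forall m : int, exact_at (cdiff X (m + 1) m) (cdiff X m (m - 1)).

Definition tilde (X : Ch A) : Prop :=
  exact_complex X /\ forall m : int, exists k, is_cycles X m k /\ C k.

End ComplexClasses.

Section ChAbelian.
Variables (A : preadditive) (abA : abelian A).
Implicit Types X Y : complex A.

Lemma kernel_monic (k x y : A) (i : hom k x) (f : hom x y) :
  is_kernel i f -> monic i.
Proof.
move=> [fi iU] w g h e.
have [u [_ uP]] : exists! h : hom w k, i \co h = i \co g.
  by apply: iU; rewrite compmA fi comp0m.
by rewrite -(uP g) // (uP h).
Qed.

Lemma cokernel_epic (x y c : A) (p : hom y c) (f : hom x y) :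
  is_cokernel p f -> epic p.
Proof.
move=> [pf pU] w g h e.
have [u [_ uP]] : exists! h : hom c w, h \co p = g \co p.
  by apply: pU; rewrite -compmA pf compm0.
by rewrite -(uP g) // (uP h).
Qed.

Lemma kernelP (x y : A) (f : hom x y) :
  {k : A & {i : hom k x | is_kernel i f}}.
Proof. by have /cid[k /cid[i iP]] := abelian_kernel abA f; exists k, i. Qed.

Lemma cokernelP (x y : A) (f : hom x y) :
  {c : A & {p : hom y c | is_cokernel p f}}.
Proof. by have /cid[c /cid[p pP]] := abelian_cokernel abA f; exists c, p. Qed.

Lemma ch_is_kernel (K X Y : Ch A) (i : hom K X) (f : hom X Y) :
  (forall m, is_kernel (cmap i m) (cmap f m)) -> is_kernel i f.
Proof.
move=> iP; split.
  by apply: chain_mapP => m; have [+ _] := iP m.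
move=> Z g fg0.
have fgm m : cmap f m \co cmap g m = 0.
  by have := congr1 (fun u : chain_map Z Y => u m) fg0.
pose h m : hom (cterm Z m) (cterm K m) := sval (cid ((iP m).2 _ _ (fgm m))).
have hP m : cmap i m \co h m = cmap g m.
  by rewrite /h; case: cid => u [].
have hC a b : cdiff K a b \co h a = h b \co cdiff Z a b.
  apply: (kernel_monic (iP b)).
  by rewrite !compmA -cmap_comm -compmA !hP cmap_comm.
exists (ChainMap hC); split; first by apply: chain_mapP => m; exact: hP.
move=> h' h'P; apply: chain_mapP => m /=.
apply: (kernel_monic (iP m)); rewrite hP -h'P //.
Qed.

Lemma ch_is_cokernel (X Y C : Ch A) (p : hom Y C) (f : hom X Y) :
  (forall m, is_cokernel (cmap p m) (cmap f m)) -> is_cokernel p f.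
Proof.
move=> pP; split.
  by apply: chain_mapP => m; have [+ _] := pP m.
move=> Z g gf0.
have gfm m : cmap g m \co cmap f m = 0.
  by have := congr1 (fun u : chain_map X Z => u m) gf0.
pose h m : hom (cterm C m) (cterm Z m) := sval (cid ((pP m).2 _ _ (gfm m))).
have hP m : h m \co cmap p m = cmap g m.
  by rewrite /h; case: cid => u [].
have hC a b : cdiff Z a b \co h a = h b \co cdiff C a b.
  apply: (cokernel_epic (pP a)).
  by rewrite -!compmA hP !cmap_comm compmA hP.
exists (ChainMap hC); split; first by apply: chain_mapP => m; exact: hP.
move=> h' h'P; apply: chain_mapP => m /=.
apply: (cokernel_epic (pP m)); rewrite hP -h'P //.
Qed.

Lemma ch_kernel (X Y : Ch A) (f : hom X Y) :
  exists (K : Ch A) (i : hom K X),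
    forall m, is_kernel (cmap i m) (cmap f m).
Proof.
pose k m := projT1 (kernelP (cmap f m)).
pose i m : hom (k m) (cterm X m) := sval (projT2 (kernelP (cmap f m))).
have iP m : is_kernel (i m) (cmap f m) := svalP (projT2 (kernelP (cmap f m))).
have dP a b : exists! h : hom (k a) (k b), i b \co h = cdiff X a b \co i a.
  apply: (iP b).2.
  by rewrite compmA -cmap_comm -compmA (iP a).1 compm0.
pose d a b := sval (cid (dP a b)).
have dE a b : i b \co d a b = cdiff X a b \co i a.
  by rewrite /d; case: cid => u [].
have dS a b : a != b + 1 -> d a b = 0.
  move=> ab; apply: (kernel_monic (iP b)).
  by rewrite dE cdiff_shape // comp0m compm0.
have dd a b c : d b c \co d a b = 0.
  apply: (kernel_monic (iP c)).
  by rewrite compmA dE -compmA dE compmA cdiff_cdiff comp0m compm0.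
pose K : Ch A := Complex dS dd.
have iC a b : cdiff X a b \co i a = i b \co cdiff K a b by rewrite /= dE.
by exists K, (@ChainMap A K X i iC).
Qed.

Lemma ch_cokernel (X Y : Ch A) (f : hom X Y) :
  exists (C : Ch A) (p : hom Y C),
    forall m, is_cokernel (cmap p m) (cmap f m).
Proof.
pose c m := projT1 (cokernelP (cmap f m)).
pose p m : hom (cterm Y m) (c m) := sval (projT2 (cokernelP (cmap f m))).
have pP m : is_cokernel (p m) (cmap f m) :=
  svalP (projT2 (cokernelP (cmap f m))).
have dP a b : exists! h : hom (c a) (c b), h \co p a = p b \co cdiff Y a b.
  apply: (pP a).2.
  by rewrite -compmA cmap_comm compmA (pP b).1 comp0m.
pose d a b := sval (cid (dP a b)).
have dE a b : d a b \co p a = p b \co cdiff Y a b.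
  by rewrite /d; case: cid => u [].
have dS a b : a != b + 1 -> d a b = 0.
  move=> ab; apply: (cokernel_epic (pP a)).
  by rewrite dE cdiff_shape // comp0m compm0.
have dd a b e : d b e \co d a b = 0.
  apply: (cokernel_epic (pP a)).
  by rewrite -compmA dE compmA dE -compmA cdiff_cdiff comp0m compm0.
pose C : Ch A := Complex dS dd.
have pC a b : cdiff C a b \co p a = p b \co cdiff Y a b by rewrite /= dE.
by exists C, (@ChainMap A Y C p pC).
Qed.

Lemma monic_kernel_cokernel (x y c : A) (f : hom x y) (p : hom y c) :
  monic f -> is_cokernel p f -> is_kernel f p.
Proof.
move=> mf [pf pU]; split=> // w g pg0.
have [z [q [qf qU]]] := abelian_monic abA mf.
have [u [uP _]] := pU _ q qf.
by apply: qU; rewrite -uP -compmA pg0 compm0.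
Qed.

Lemma epic_cokernel_kernel (k x y : A) (f : hom x y) (i : hom k x) :
  epic f -> is_kernel i f -> is_cokernel f i.
Proof.
move=> ef [fi iU]; split=> // w g gi0.
have [z [q [fq qU]]] := abelian_epic abA ef.
have [u [uP _]] := iU _ q fq.
by apply: qU; rewrite -uP compmA gi0 comp0m.
Qed.

Lemma ch_monic (X Y : Ch A) (f : hom X Y) :
  monic f -> forall m, monic (cmap f m).
Proof.
move=> mf m; have [K [i iP]] := ch_kernel f.
have i0 : i = 0.
  by apply: mf; rewrite (ch_is_kernel iP).1 compm0.
move=> w g h e.
have /(iP m).2[u [+ _]] : cmap f m \co (g - h) = 0.
  by rewrite compmDr compmN e subrr.
by rewrite i0 comp0m => /esym/eqP; rewrite subr_eq0 => /eqP.
Qed.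

Lemma ch_epic (X Y : Ch A) (f : hom X Y) :
  epic f -> forall m, epic (cmap f m).
Proof.
move=> ef m; have [C [p pP]] := ch_cokernel f.
have p0 : p = 0.
  by apply: ef; rewrite (ch_is_cokernel pP).1 comp0m.
move=> w g h e.
have /(pP m).2[u [+ _]] : (g - h) \co cmap f m = 0.
  by rewrite compmDl compNm e subrr.
by rewrite p0 compm0 => /esym/eqP; rewrite subr_eq0 => /eqP.
Qed.

Lemma ch_zero : exists Z : Ch A, is_zero Z.
Proof.
have [z [zt zi]] := abelian_zero abA.
have dd (i j k : int) : (0 : hom z z) \co (0 : hom z z) = 0 by rewrite comp0m.
exists (@Complex A (fun=> z) (fun _ _ => 0) (fun _ _ _ => erefl) dd).
by split=> X f; apply: chain_mapP => m; [exact: zt | exact: zi].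
Qed.

Lemma ch_biproduct (X Y : Ch A) : exists (S : Ch A) (i1 : hom X S)
  (i2 : hom Y S) (p1 : hom S X) (p2 : hom S Y), is_biproduct i1 i2 p1 p2.
Proof.
have bP (m : int) : {s : A &
   {i1 : hom (cterm X m) s & {i2 : hom (cterm Y m) s &
   {p1 : hom s (cterm X m) & {p2 : hom s (cterm Y m) |
   is_biproduct i1 i2 p1 p2}}}}}.
  have /cid[s /cid[i1 /cid[i2 /cid[p1 /cid[p2 H]]]]] :=
    abelian_biproduct abA (cterm X m) (cterm Y m).
  by exists s, i1, i2, p1, p2.
pose s m := projT1 (bP m).
pose i1 m : hom (cterm X m) (s m) := projT1 (projT2 (bP m)).
pose i2 m : hom (cterm Y m) (s m) := projT1 (projT2 (projT2 (bP m))).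
pose p1 m : hom (s m) (cterm X m) := projT1 (projT2 (projT2 (projT2 (bP m)))).
pose p2 m : hom (s m) (cterm Y m) :=
  sval (projT2 (projT2 (projT2 (projT2 (bP m))))).
have B m : is_biproduct (i1 m) (i2 m) (p1 m) (p2 m) :=
  svalP (projT2 (projT2 (projT2 (projT2 (bP m))))).
pose d a b : hom (s a) (s b) :=
  i1 b \co cdiff X a b \co p1 a + i2 b \co cdiff Y a b \co p2 a.
have di1 a b : d a b \co i1 a = i1 b \co cdiff X a b.
  have [e1 e2 e3 e4 e5] := B a.
  by rewrite compmDl -!compmA e1 e3 !compm0 compm1 addr0.
have di2 a b : d a b \co i2 a = i2 b \co cdiff Y a b.
  have [e1 e2 e3 e4 e5] := B a.
  by rewrite compmDl -!compmA e2 e4 !compm0 compm1 add0r.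
have p1d a b : cdiff X a b \co p1 a = p1 b \co d a b.
  have [e1 e2 e3 e4 e5] := B b.
  by rewrite compmDr !compmA e1 e4 !comp0m comp1m addr0.
have p2d a b : cdiff Y a b \co p2 a = p2 b \co d a b.
  have [e1 e2 e3 e4 e5] := B b.
  by rewrite compmDr !compmA e2 e3 !comp0m comp1m add0r.
have dS a b : a != b + 1 -> d a b = 0.
  by move=> ab; rewrite /d !cdiff_shape // !compm0 !comp0m addr0.
have dd a b c : d b c \co d a b = 0.
  rewrite {2}/d compmDr !compmA di1 di2 -(compmA (i1 c)) -(compmA (i2 c)).
  by rewrite !cdiff_cdiff !compm0 !comp0m addr0.
pose S : Ch A := Complex dS dd.
exists S, (@ChainMap A X S i1 di1), (@ChainMap A Y S i2 di2),
  (@ChainMap A S X p1 p1d), (@ChainMap A S Y p2 p2d).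
by split; apply: chain_mapP => m; have [e1 e2 e3 e4 e5] := B m.
Qed.

Lemma ch_abelian : abelian (Ch A).
Proof.
split.
- exact: ch_zero.
- exact: ch_biproduct.
- move=> X Y f; have [K [i iP]] := ch_kernel f.
  by exists K, i; exact: ch_is_kernel.
- move=> X Y f; have [C [p pP]] := ch_cokernel f.
  by exists C, p; exact: ch_is_cokernel.
- move=> X Y f /ch_monic mf; have [C [p pP]] := ch_cokernel f.
  exists C, p; apply: ch_is_kernel => m.
  by apply: monic_kernel_cokernel.
- move=> X Y f /ch_epic ef; have [K [i iP]] := ch_kernel f.
  exists K, i; apply: ch_is_cokernel => m.
  by apply: epic_cokernel_kernel.
Qed.

End ChAbelian.

(* Main.v *)
(* For complexes X and Y such that Ext^i(X_m, Y_n) = 0 for all i >= 1 and all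
   m, n, and such that the complex Hom(X, Y) is acyclic, all Ext^i(X, Y),
   i >= 1, vanish: when i = 1 the obstruction to splitting an extension, which
   splits in each degree, is a cocycle of Hom(X, Y), and both hypotheses pass
   to the syzygies of X. Since Ext^1(omega, omega) = 0, complexes in the
   class of exact complexes with cycles in omega are contractible (likewise
   for nu), so Hom(X, Y) is acyclic as soon as X or Y is one of them; by
   induction this extends to complexes with finite resolutions by them.

   In any abelian category with enough projectives, a finite balanced system
   gives a balanced pair. An object M of X^wedge has an Auslander-Buchweitz
   approximation 0 -> K -> Z -> M -> 0 with Z in X and K in omega^wedge, and
   K is then resolved by omega. A map from K to y in Y lifts along the cover
   v -> y by v in nu, as Ext^1(omega^wedge, Y) = 0, and then extends to Z, as
   Ext^1(X^wedge, nu) = 0. The other half is dual. *)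

From mathcomp Require Import all_boot all_order all_algebra.
From mathcomp Require Import boolp.
From Stdlib Require Import Relations.
Require Import Defs.

Set Implicit Arguments.
Unset Strict Implicit.
Unset Printing Implicit Defensive.

Import GRing.Theory.
Local Open Scope ring_scope.

(** [ext_zero] only says that any two Yoneda extensions are joined by a zigzag of maps; no group
    structure is at hand. With enough projectives it is put into usable form: Ext^1(x, y) = 0
    becomes [splits x y], and higher degrees reduce to it by syzygies. Going from x to its syzygy is
    the delicate direction, since a zigzag between two splices need not consist of splices. A
    projective resolution supplies an invariant of zigzags, the cocycle of an extension modulo
    coboundaries, and comparison with an extension that retracts onto y shows it to be trivial.

    [splits] is self-dual, while projective resolutions are not. Hence the argument for balanced
    pairs assumes splitting conditions only, and its second half is the first one read in [opc B],
    with Ext eliminated in B beforehand.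

    For complexes, syzygies keep Hom(X, Y) acyclic because a projective cover can be taken free on a
    graded projective object, hence contractible. *)

Definition opc (B : preadditive) : preadditive :=
  @Preadditive (obj B) (fun x y => hom y x) (@idm B)
    (fun x y z g f => f \co g)
    (fun x y f => comp1m f) (fun x y f => compm1 f)
    (fun x y z t h g f => esym (compmA f g h))
    (fun x y z g g' f => compmDr f g g')
    (fun x y z g f f' => compmDl f f' g).

(** * Exact sequences in an abelian category *)

Section Preadditive.
Variable B : preadditive.
Implicit Types a b c x y z w : B.

Lemma compmBl x y z (g g' : hom y z) (f : hom x y) :
  (g - g') \co f = g \co f - g' \co f.
Proof. by rewrite compmDl compNm. Qed.

Lemma compmBr x y z (g : hom y z) (f f' : hom x y) :
  g \co (f - f') = g \co f - g \co f'.
Proof. by rewrite compmDr compmN. Qed.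

Lemma monicI x y (f : hom x y) :
  (forall w (h : hom w x), f \co h = 0 -> h = 0) -> monic f.
Proof.
move=> f0 w g h e; apply/eqP; rewrite -subr_eq0; apply/eqP/f0.
by rewrite compmBr e subrr.
Qed.

Lemma monic_eq0 x y (f : hom x y) w (h : hom w x) :
  monic f -> f \co h = 0 -> h = 0.
Proof. by move=> mf fh; apply: mf; rewrite fh compm0. Qed.

Lemma epicI x y (f : hom x y) :
  (forall w (h : hom y w), h \co f = 0 -> h = 0) -> epic f.
Proof.
move=> f0 w g h e; apply/eqP; rewrite -subr_eq0; apply/eqP/f0.
by rewrite compmBl e subrr.
Qed.

Lemma epic_eq0 x y (f : hom x y) w (h : hom y w) :
  epic f -> h \co f = 0 -> h = 0.
Proof. by move=> ef hf; apply: ef; rewrite hf comp0m. Qed.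

Lemma kernelI k x y (i : hom k x) (f : hom x y) :
  f \co i = 0 -> monic i ->
  (forall w (g : hom w x), f \co g = 0 -> exists h, i \co h = g) ->
  is_kernel i f.
Proof.
move=> fi mi iU; split=> // w g /iU[h hP]; exists h; split=> // h' h'P.
by apply: mi; rewrite hP h'P.
Qed.

Lemma kernel_lift k x y (i : hom k x) (f : hom x y) w (g : hom w x) :
  is_kernel i f -> f \co g = 0 -> exists h, i \co h = g.
Proof. by move=> [_ iU] /iU[h [hP _]]; exists h. Qed.

End Preadditive.

Section Cokernels.
Variable B : preadditive.
Implicit Types a b c x y z w : B.

Lemma cokernelI x y c (p : hom y c) (f : hom x y) :
  p \co f = 0 -> epic p ->
  (forall w (g : hom y w), g \co f = 0 -> exists h, h \co p = g) ->
  is_cokernel p f.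
Proof. exact: (@kernelI (opc B) _ _ _ p f). Qed.

Lemma cokernel_extend x y c (p : hom y c) (f : hom x y) w (g : hom y w) :
  is_cokernel p f -> g \co f = 0 -> exists h, h \co p = g.
Proof. exact: (@kernel_lift (opc B) _ _ _ p f w g). Qed.

Lemma kernel_comp0 k x y (i : hom k x) (f : hom x y) :
  is_kernel i f -> f \co i = 0.
Proof. by case. Qed.

Lemma cokernel_comp0 x y c (p : hom y c) (f : hom x y) :
  is_cokernel p f -> p \co f = 0.
Proof. by case. Qed.

Lemma kernel_iso k k' x y (i : hom k x) (i' : hom k' x) (f : hom x y) :
  is_kernel i f -> is_kernel i' f ->
  exists u : hom k' k, is_iso u /\ i \co u = i'.
Proof.
move=> iP i'P; have [u uP] := kernel_lift iP (kernel_comp0 i'P).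
have [v vP] := kernel_lift i'P (kernel_comp0 iP).
exists u; split=> //; exists v; split.
  by apply: (kernel_monic i'P); rewrite compmA vP uP compm1.
by apply: (kernel_monic iP); rewrite compmA uP vP compm1.
Qed.

Lemma iso_monic x y (f : hom x y) : is_iso f -> monic f.
Proof.
by move=> [g [gf _]]; apply: monicI => w h fh;
  rewrite -[h]comp1m -gf -compmA fh compm0.
Qed.

Lemma iso_epic x y (f : hom x y) : is_iso f -> epic f.
Proof.
by move=> [g [_ fg]]; apply: epicI => w h hf;
  rewrite -[h]compm1 -fg compmA hf comp0m.
Qed.

Lemma idm_iso x : is_iso (idm x).
Proof. by exists (idm x); rewrite comp1m. Qed.

Lemma monic_comp x y z (g : hom y z) (f : hom x y) :
  monic g -> monic f -> monic (g \co f).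
Proof. by move=> mg mf w h h' e; apply/mf/mg; rewrite !compmA. Qed.

Lemma epic_comp x y z (g : hom y z) (f : hom x y) :
  epic g -> epic f -> epic (g \co f).
Proof. by move=> eg ef w h h' e; apply/eg/ef; rewrite -!compmA. Qed.

Lemma epic_compr x y z (g : hom y z) (f : hom x y) : epic (g \co f) -> epic g.
Proof. by move=> e w h h' hg; apply: e; rewrite !compmA hg. Qed.

Lemma kernel_monic_comp k x y z (i : hom k x) (f : hom x y) (m : hom y z) :
  monic m -> is_kernel i f -> is_kernel i (m \co f).
Proof.
move=> mm iP; apply: kernelI; first by rewrite -compmA (kernel_comp0 iP) compm0.
  exact: kernel_monic iP.
move=> w g; rewrite -compmA => /(monic_eq0 mm); exact: kernel_lift.
Qed.

Lemma kernel_comp_iso k k' x y (i : hom k x) (f : hom x y) (u : hom k' k) :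
  is_kernel i f -> is_iso u -> is_kernel (i \co u) f.
Proof.
move=> iP uP; apply: kernelI; first by rewrite compmA (kernel_comp0 iP) comp0m.
  by apply: monic_comp; [exact: kernel_monic iP | exact: iso_monic].
move=> w g /(kernel_lift iP)[h hP]; have [v [_ uv]] := uP.
by exists (v \co h); rewrite -compmA (compmA u) uv comp1m.
Qed.

(** Kernel-cokernel pairs avoid images, and passing to [opc] merely swaps the two conditions. *)
Definition ses x y z (f : hom x y) (g : hom y z) : Prop :=
  is_kernel f g /\ is_cokernel g f.

Lemma ses_comp0 x y z (f : hom x y) (g : hom y z) : ses f g -> g \co f = 0.
Proof. by case=> [[]]. Qed.

Lemma ses_monic x y z (f : hom x y) (g : hom y z) : ses f g -> monic f.
Proof. by case=> /kernel_monic. Qed.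

Lemma ses_epic x y z (f : hom x y) (g : hom y z) : ses f g -> epic g.
Proof. by case=> _ /cokernel_epic. Qed.

Lemma ses_lift x y z (f : hom x y) (g : hom y z) w (h : hom w y) :
  ses f g -> g \co h = 0 -> exists h', f \co h' = h.
Proof. by case=> /kernel_lift H _; exact: H. Qed.

Lemma ses_extend x y z (f : hom x y) (g : hom y z) w (h : hom y w) :
  ses f g -> h \co f = 0 -> exists h', h' \co g = h.
Proof. by case=> _ /cokernel_extend; exact. Qed.

(** Lets an isomorphism be handled as a short exact sequence, for instance at the end of a finite
    resolution. *)
Lemma zero_iso_ses z x y (f : hom x y) :
  is_zero z -> is_iso f -> ses (0 : hom z x) f.
Proof.
move=> [zt zi] fiso; have [g [gf fg]] := fiso; split.
  apply: kernelI; rewrite ?compm0 //.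
    by apply: monicI => w h _; exact: zt.
  by move=> w h /(monic_eq0 (iso_monic fiso)) ->; exists 0; rewrite compm0.
apply: cokernelI; rewrite ?compm0 //; first exact: iso_epic.
by move=> w h _; exists (h \co g); rewrite -compmA gf compm1.
Qed.

(** Ext^1(x, y) = 0 without reference to Yoneda classes. *)
Definition splits x y : Prop :=
  forall e (j : hom y e) (p : hom e x), ses j p -> exists s, p \co s = idm x.

Lemma section_retraction x y e (j : hom y e) (p : hom e x) (s : hom x e) :
  ses j p -> p \co s = idm x ->
  exists r, r \co j = idm y /\ j \co r + s \co p = idm e.
Proof.
move=> jp ps; have [|r rP] := ses_lift (h := idm e - s \co p) jp.
  by rewrite compmBr compm1 compmA ps comp1m subrr.
exists r; split; last by rewrite rP subrK.
apply: (ses_monic jp); rewrite compmA rP compmBl comp1m -compmA.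
by rewrite (ses_comp0 jp) compm0 subr0 compm1.
Qed.

Lemma biproduct_ses x y s (i1 : hom x s) (i2 : hom y s)
    (p1 : hom s x) (p2 : hom s y) :
  is_biproduct i1 i2 p1 p2 -> ses i1 p2.
Proof.
case=> [e1 e2 e3 e4 e5]; split.
  apply: kernelI => //.
    by apply: monicI => w h e; rewrite -[h]comp1m -e1 -compmA e compm0.
  move=> w g e; exists (p1 \co g); rewrite -[RHS]comp1m -e5 compmDl -!compmA e.
  by rewrite compm0 addr0.
apply: cokernelI => //.
  by apply: epicI => w h e; rewrite -[h]compm1 -e2 compmA e comp0m.
move=> w g e; exists (g \co i2); rewrite -[RHS]compm1 -e5 compmDr !compmA e.
by rewrite comp0m add0r.
Qed.

(* [a -f-> b] and [a -g-> a'] completed by [b -g'-> b'] and [a' -f'-> b']. *)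
Definition is_pushout a b a' b' (f : hom a b) (g : hom a a')
    (g' : hom b b') (f' : hom a' b') : Prop :=
  [/\ g' \co f = f' \co g,
      forall w (u : hom b w) (v : hom a' w), u \co f = v \co g ->
        exists h, h \co g' = u /\ h \co f' = v
    & forall w (h : hom b' w), h \co g' = 0 -> h \co f' = 0 -> h = 0].

Lemma pushout_sym a b a' b' (f : hom a b) (g : hom a a')
    (g' : hom b b') (f' : hom a' b') :
  is_pushout f g g' f' -> is_pushout g f f' g'.
Proof.
case=> [e U j]; split=> // [w u v uv|w h h1 h2]; last exact: j.
by have [|h []] := U _ v u; [rewrite uv | exists h].
Qed.

Lemma cokernel_pushout a b a' s c (f : hom a b) (g : hom a a')
    (i1 : hom b s) (i2 : hom a' s) (p1 : hom s b) (p2 : hom s a')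
    (q : hom s c) :
  is_biproduct i1 i2 p1 p2 -> is_cokernel q (i1 \co f - i2 \co g) ->
  is_pushout f g (q \co i1) (q \co i2).
Proof.
move=> sP qP; have [e1 e2 e3 e4 e5] := sP; split.
- apply/eqP; rewrite -subr_eq0 -!compmA -compmBr; apply/eqP.
  exact: cokernel_comp0 qP.
- move=> w u v uv; have uvi1 : (u \co p1 + v \co p2) \co i1 = u.
    by rewrite compmDl -!compmA e1 e3 compm1 compm0 addr0.
  have uvi2 : (u \co p1 + v \co p2) \co i2 = v.
    by rewrite compmDl -!compmA e2 e4 compm1 compm0 add0r.
  have [|h hP] := cokernel_extend (g := u \co p1 + v \co p2) qP.
    by rewrite compmBr !(compmA _ i1) !(compmA _ i2) uvi1 uvi2 uv subrr.
  by exists h; rewrite !compmA hP.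
- move=> w h h1 h2; apply: (epic_eq0 (cokernel_epic qP)).
  by rewrite -[LHS]compm1 -e5 compmDr !compmA -(compmA h q i1) -(compmA h q i2)
    h1 h2 !comp0m addr0.
Qed.

Lemma pushout_cokernel a b c a' b' (f : hom a b) (g : hom a a')
    (g' : hom b b') (f' : hom a' b') (p : hom b c) :
  is_pushout f g g' f' -> is_cokernel p f ->
  exists p' : hom b' c, p' \co g' = p /\ is_cokernel p' f'.
Proof.
move=> [e U j] pP; have [|p' [p'g p'f]] := U _ p (0 : hom a' c).
  by rewrite (cokernel_comp0 pP) comp0m.
exists p'; split=> //; apply: cokernelI => //.
  by apply: (@epic_compr _ _ _ _ g'); rewrite p'g; exact: cokernel_epic pP.
move=> w u uf; have [|h hP] := cokernel_extend (g := u \co g') pP.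
  by rewrite -compmA e compmA uf comp0m.
exists h; apply/eqP; rewrite -subr_eq0; apply/eqP/j.
  by rewrite compmBl -compmA p'g hP subrr.
by rewrite compmBl -compmA p'f compm0 uf subrr.
Qed.

Lemma pushout_epic_cokernel a b a' b' k (f : hom a b) (g : hom a a')
    (g' : hom b b') (f' : hom a' b') (i : hom k a) :
  is_pushout f g g' f' -> is_cokernel g i -> is_cokernel g' (f \co i).
Proof.
move=> [e U j] gP; apply: cokernelI.
- by rewrite compmA e -compmA (cokernel_comp0 gP) compm0.
- apply: epicI => w h hg; apply: j => //; apply: (epic_eq0 (cokernel_epic gP)).
  by rewrite -compmA -e compmA hg comp0m.
- move=> w u; rewrite compmA => /(cokernel_extend gP)[v vP].
  by have [|h [hg _]] := U _ u v; [rewrite vP | exists h].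
Qed.

End Cokernels.

Section Abelian.
Variables (B : preadditive) (abB : abelian B).
Implicit Types a b c x y z w : B.

Lemma monic_epic_iso x y (f : hom x y) : monic f -> epic f -> is_iso f.
Proof.
move=> mf ef; have [z [g fP]] := abelian_monic abB mf.
have g0 : g = 0 by apply: (epic_eq0 ef); exact: kernel_comp0 fP.
have [|h hP] := kernel_lift (g := idm y) fP; first by rewrite g0 comp0m.
by exists h; split=> //; apply: mf; rewrite compmA hP comp1m compm1.
Qed.

Lemma short_exactE x y z (f : hom x y) (g : hom y z) :
  short_exact f g <-> ses f g.
Proof.
split=> [[mf [k [i [[c [p [pP iP]]] ig]]] eg]|[fP gP]].
  have fp := monic_kernel_cokernel abB mf pP.
  have [u [uiso uf]] := kernel_iso ig ig.
  have [v [viso vf]] := kernel_iso iP fp.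
  have fg : is_kernel f g by rewrite -vf; exact: kernel_comp_iso.
  by split=> //; exact: epic_cokernel_kernel.
split; [exact: kernel_monic fP | | exact: cokernel_epic gP].
by exists x, f; split=> //; exists z, g.
Qed.

Lemma monic_ses x y (f : hom x y) :
  monic f -> exists c (p : hom y c), ses f p.
Proof.
move=> mf; have [c [p pP]] := abelian_cokernel abB f.
by exists c, p; split=> //; exact: monic_kernel_cokernel.
Qed.

Lemma epic_ses x y (f : hom x y) :
  epic f -> exists k (i : hom k x), ses i f.
Proof.
move=> ef; have [k [i iP]] := abelian_kernel abB f.
by exists k, i; split=> //; exact: epic_cokernel_kernel.
Qed.

(** If u kills e and l is the kernel of u, then f factors through the monic [i \co l]. The cokernel
    of that monic kills f, hence factors through p and kills i. So i factors through [i \co l],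
    which makes l split epic and u zero. *)
Lemma image_epic x y c k (f : hom x y) (p : hom y c) (i : hom k y)
    (e : hom x k) :
  is_cokernel p f -> is_kernel i p -> i \co e = f -> epic e.
Proof.
move=> pP iP ie; apply: epicI => w u ue.
have [k' [l lP]] := abelian_kernel abB u.
have [e' e'P] := kernel_lift lP ue.
have ml : monic (i \co l).
  by apply: monic_comp; [exact: kernel_monic iP | exact: kernel_monic lP].
have [d [q qP]] := monic_ses ml.
have [|r rP] := cokernel_extend (g := q) pP.
  by rewrite -ie -e'P !compmA -(compmA q) (ses_comp0 qP) comp0m.
have [|t tP] := ses_lift (h := i) qP.
  by rewrite -rP -compmA (kernel_comp0 iP) compm0.
have lt : l \co t = idm k.
  by apply: (kernel_monic iP); rewrite compmA tP compm1.
by rewrite -[u]compm1 -lt compmA (kernel_comp0 lP) comp0m.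
Qed.

Lemma exact_atE x y z (f : hom x y) (g : hom y z) :
  exact_at f g <->
  exists k (i : hom k y)
    (e : hom x k), [/\ is_kernel i g, epic e & i \co e = f].
Proof.
split=> [[k [i [[c [p [pP iP]]] ig]]]|[k [i [e [ig ee ie]]]]].
  have [e eP] := kernel_lift iP (cokernel_comp0 pP).
  by exists k, i, e; split=> //; exact: image_epic pP iP eP.
exists k, i; split=> //.
have [c [p [ip pi]]] := monic_ses (kernel_monic ig).
exists c, p; split=> //; apply: cokernelI.
- by rewrite -ie compmA (kernel_comp0 ip) comp0m.
- exact: cokernel_epic pi.
- move=> w h; rewrite -ie compmA => /(epic_eq0 ee); exact: cokernel_extend.
Qed.

Lemma exact_at_comp0 x y z (f : hom x y) (g : hom y z) :
  exact_at f g -> g \co f = 0.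
Proof.
by move=> /exact_atE[k [i [e [ig _ <-]]]];
  rewrite compmA (kernel_comp0 ig) comp0m.
Qed.

Lemma exact_at_monicr x y z t (f : hom x y) (g : hom y z) (m : hom z t) :
  monic m -> exact_at f g -> exact_at f (m \co g).
Proof.
move=> mm /exact_atE[k [i [e [ig ee ie]]]]; apply/exact_atE.
by exists k, i, e; split=> //; exact: kernel_monic_comp.
Qed.

Lemma pushout_exists a b a' (f : hom a b) (g : hom a a') :
  exists b' (g' : hom b b') (f' : hom a' b'), is_pushout f g g' f'.
Proof.
have [s [i1 [i2 [p1 [p2 sP]]]]] := abelian_biproduct abB b a'.
have [c [q qP]] := abelian_cokernel abB (i1 \co f - i2 \co g).
by exists c, (q \co i1), (q \co i2); exact: cokernel_pushout sP qP.
Qed.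

(** In the biproduct, [i1 \co f - i2 \co g] is monic because p1 recovers f from it, so it is the
    kernel of its cokernel q. If f' kills h, then [i2 \co h] lies in this kernel, and p1 shows that
    it is zero. *)
Lemma pushout_monic a b a' b' (f : hom a b) (g : hom a a')
    (g' : hom b b') (f' : hom a' b') :
  is_pushout f g g' f' -> monic f -> monic f'.
Proof.
move=> [e U j] mf.
have [s [i1 [i2 [p1 [p2 sP]]]]] := abelian_biproduct abB b a'.
have [e1 e2 e3 e4 e5] := sP.
have p1d : p1 \co (i1 \co f - i2 \co g) = f.
  by rewrite compmBr !compmA e1 e4 comp1m comp0m subr0.
have p2d : p2 \co (i1 \co f - i2 \co g) = - g.
  by rewrite compmBr !compmA e2 e3 comp1m comp0m sub0r.
have [c [q qP]] : exists c (q : hom s c), ses (i1 \co f - i2 \co g) q.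
  by apply: monic_ses; apply: monicI => w h h0; apply: (monic_eq0 mf);
     rewrite -p1d -compmA h0 compm0.
have [|t [tg tf]] := U _ (q \co i1) (q \co i2).
  apply/eqP; rewrite -subr_eq0 -!compmA -compmBr; apply/eqP.
  exact: ses_comp0 qP.
apply: monicI => w h fh.
have [|r rP] := ses_lift (h := i2 \co h) qP.
  by rewrite compmA -tf -compmA fh compm0.
have r0 : r = 0.
  by apply: (monic_eq0 mf); rewrite -p1d -compmA rP compmA e4 comp0m.
by rewrite -[h]comp1m -e2 -compmA -rP r0 !compm0.
Qed.

Lemma ses_pushout a b c a' b' (f : hom a b) (p : hom b c) (g : hom a a')
    (g' : hom b b') (f' : hom a' b') :
  ses f p -> is_pushout f g g' f' ->
  exists p' : hom b' c, p' \co g' = p /\ ses f' p'.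
Proof.
move=> [fp pf] po; have [p' [p'g p'P]] := pushout_cokernel po pf.
exists p'; split=> //; split=> //; apply: monic_kernel_cokernel => //.
by apply: pushout_monic po _; exact: kernel_monic fp.
Qed.

Lemma ses_pushout_epic a b a' b' k (f : hom a b) (g : hom a a')
    (g' : hom b b') (f' : hom a' b') (i : hom k a) :
  is_pushout f g g' f' -> monic f -> ses i g -> ses (f \co i) g'.
Proof.
move=> po mf [ig gi]; have q := pushout_epic_cokernel po gi.
split=> //; apply: monic_kernel_cokernel => //.
by apply: monic_comp => //; exact: kernel_monic ig.
Qed.

(** The obstruction to extending u is the pushout of the sequence along u; a retraction of the
    pushout gives the extension. *)
Lemma splits_extend c a w b (f : hom a b) (p : hom b c) (u : hom a w) :
  ses f p -> splits c w -> exists h, h \co f = u.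
Proof.
move=> fp cw; have [b' [g' [f' po]]] := pushout_exists f u.
have [p' [_ fp']] := ses_pushout fp po.
have [s sP] := cw _ _ _ fp'; have [r [rf _]] := section_retraction fp' sP.
by exists (r \co g'); have [e _ _] := po; rewrite -compmA e compmA rf comp1m.
Qed.

End Abelian.

Lemma op_abelian (B : preadditive) : abelian B -> abelian (opc B).
Proof.
case=> [[z [z1 z2]] bi ker coker mo ep]; split=> //.
- by exists z.
- move=> x y; have [s [i1 [i2 [p1 [p2 [e1 e2 e3 e4 e5]]]]]] := bi x y.
  by exists s, p1, p2, i1, i2.
- by move=> x y f; exact: (coker _ _ f).
- by move=> x y f; exact: (ker _ _ f).
- by move=> x y f; exact: (ep _ _ f).
- by move=> x y f; exact: (mo _ _ f).
Qed.

(** * Duality *)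

Section Duals.
Variables (B : preadditive).
Implicit Types a b c x y z w : B.

Lemma op_ses x y z (f : hom x y) (g : hom y z) :
  ses f g -> @ses (opc B) z y x g f.
Proof. by case. Qed.

Lemma op_splits x y : splits x y -> @splits (opc B) y x.
Proof.
move=> xy e j p [pk jk]; have jp : @ses B _ _ _ p j by [].
by have [s /(section_retraction jp)[r [rP _]]] := xy _ _ _ jp; exists r.
Qed.

Variable abB : abelian B.
Let abB' := op_abelian abB.

Lemma splits_lift x a b c (f : hom a b) (p : hom b c) (u : hom x c) :
  ses f p -> splits x a -> exists h, p \co h = u.
Proof.
move=> fp xa.
exact: (@splits_extend (opc B) abB' _ _ _ _ _ _ u (op_ses fp) (op_splits xa)).
Qed.

Lemma exact_at_op x y z (f : hom x y) (g : hom y z) :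
  exact_at f g -> @exact_at (opc B) _ _ _ g f.
Proof.
move=> /(exact_atE abB)[k [i [e [ig ee ie]]]]; apply/(exact_atE abB').
have [c [p [ip pi]]] := monic_ses abB (kernel_monic ig).
have [m mP] := cokernel_extend pi (kernel_comp0 ig).
exists c, p, m; split=> //.
  split; first by rewrite /= -ie compmA (kernel_comp0 ip) comp0m.
  move=> w h /=; rewrite -ie compmA => /(epic_eq0 ee); exact: pi.2.
exact: (@image_epic (opc B) abB' _ _ _ _ g i p m ig pi mP).
Qed.

Lemma pullback_exists b a' b' (g' : hom b b') (f' : hom a' b') :
  exists a (f : hom a b) (g : hom a a'), @is_pushout (opc B) _ _ _ _ g' f' f g.
Proof. exact: (@pushout_exists (opc B) abB'). Qed.

End Duals.

(** * Yoneda extensions in the presence of enough projectives *)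

(* Maps from projective objects play the role of elements. *)
Section Projectives.
Variables (B : preadditive) (abB : abelian B) (epB : enough_projectives B).
Implicit Types a b c x y z w : B.

Lemma exact_lift x y z (f : hom x y) (g : hom y z) w (h : hom w y) :
  exact_at f g -> projective w -> g \co h = 0 -> exists h', f \co h' = h.
Proof.
move=> /(exact_atE abB)[k [i [e [ig ee <-]]]] wP /(kernel_lift ig)[t tP].
by have [h' h'P] := wP _ _ e t ee; exists h'; rewrite -compmA h'P.
Qed.

Lemma epic_by_lift x y (f : hom x y) :
  (forall w (h : hom w y), projective w -> exists h', f \co h' = h) -> epic f.
Proof.
move=> H; have [p [e [pP ee]]] := epB y; have [h hP] := H _ e pP.
by apply: (@epic_compr _ _ _ _ _ h); rewrite hP.
Qed.

Lemma exact_by_lift x y z (f : hom x y) (g : hom y z) :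
  g \co f = 0 ->
  (forall w (h : hom w y), projective w -> g \co h = 0 ->
     exists h', f \co h' = h) ->
  exact_at f g.
Proof.
move=> gf H; apply/(exact_atE abB).
have [k [i iP]] := abelian_kernel abB g; have [e eP] := kernel_lift iP gf.
exists k, i, e; split=> //; apply: epic_by_lift => w h wP.
have [|t tP] := H _ (i \co h) wP;
  first by rewrite compmA (kernel_comp0 iP) comp0m.
by exists t; apply: (kernel_monic iP); rewrite compmA eP.
Qed.

Lemma projective_splits x y : projective x -> splits x y.
Proof. by move=> xP e j r jr; exact: (xP _ _ r (idm x) (ses_epic jr)). Qed.

(* Split the pullback along [q -> x], then correct the section on [k]. *)
Lemma splits_quotient x y k q (i : hom k q) (p : hom q x) :
  ses i p -> splits q y ->
  (forall u : hom k y, exists h, h \co i = u) -> splits x y.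
Proof.
move=> ip qy H e j r jr; have [t tP] := splits_lift abB p jr qy.
have [|u uP] := ses_lift (h := t \co i) jr.
  by rewrite compmA tP (ses_comp0 ip).
have [v vP] := H u; have [|s sP] := ses_extend (h := t - j \co v) ip.
  by rewrite compmBl -compmA vP uP subrr.
exists s; apply: (ses_epic ip); rewrite -compmA sP compmBr tP compmA.
by rewrite (ses_comp0 jr) comp0m subr0 comp1m.
Qed.

End Projectives.

(** * Splicing and projective resolutions *)

Section Splice.
Variable B : preadditive.
Implicit Types a b c x y z w : B.

Definition lsplice x k c (i : hom k c) (p : hom c x) (E : lseq k) : lseq x :=
  @LSeq B x (fun n => if n is m.+1 then E m else c)
    (fun n => match n with 0 => i \co laug E | m.+1 => lbd E m end) p.

(** A projective resolution: [lexact E n] is silent about degree n, so every n is required. *)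
Definition lacyclic x (E : lseq x) : Prop :=
  (forall n, projective (E n)) /\ forall n, lexact E n.

Lemma lsplice_exact (abB : abelian B) x k c (i : hom k c) (p : hom c x)
    (E : lseq k) n :
  ses i p -> lexact E n -> lexact (lsplice i p E) n.+1.
Proof.
move=> ip [eE xE]; split; first exact: ses_epic ip.
case=> [_|[|m]] /=.
- by apply/(exact_atE abB); exists k, i, (laug E); split=> //; case: ip.
- move=> lt1n; apply: (exact_at_monicr abB (ses_monic ip)).
  exact: (xE 0%N).
- by move=> ltmn; exact: (xE m.+1).
Qed.

Lemma lsplice_acyclic (abB : abelian B) x k c (i : hom k c) (p : hom c x)
    (E : lseq k) :
  ses i p -> projective c -> lacyclic E -> lacyclic (lsplice i p E).
Proof.
move=> ip cP [EP EE]; split; first by case.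
case=> [|n]; first by split=> //; exact: ses_epic ip.
exact: lsplice_exact.
Qed.

Lemma lacyclic_exists (abB : abelian B) (epB : enough_projectives B) x :
  exists P : lseq x, lacyclic P.
Proof.
have /choice[Q /choice[K H]] : forall z, exists q k, exists (i : hom k q)
    (p : hom q z), projective q /\ ses i p.
  move=> z; have [q [p [qP pe]]] := epB z.
  by have [k [i ip]] := epic_ses abB pe; exists q, k, i, p.
have /cid {H}[i H] : exists i : forall z, hom (K z) (Q z), forall z,
    exists p : hom (Q z) z, projective (Q z) /\ ses (i z) p.
  by exists (fun z => sval (cid (H z))) => z; case: cid.
have /cid {H}[p H] : exists p : forall z, hom (Q z) z,
    forall z, projective (Q z) /\ ses (i z) (p z).
  by exists (fun z => sval (cid (H z))) => z; case: cid.
(* A cover has been chosen for every object at once, so the n-th syzygy is the n-th iterate of K. *)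
pose P := @LSeq B x (fun n => Q (iter n K x))
  (fun n => i (iter n K x) \co p (iter n.+1 K x)) (p x).
exists P; split=> [n|n]; first exact: (H _).1.
split=> [|m _]; first exact: ses_epic (H _).2.
have ip := (H (iter m K x)).2.
have xm : exact_at (lbd P m) (p (iter m K x)).
  apply/(exact_atE abB); exists (K (iter m K x)), (i (iter m K x)), (p _).
  by split=> //; [exact: ip.1 | exact: ses_epic (H _).2].
case: m ip xm => [|m] ip xm //=.
by apply: (exact_at_monicr abB) xm; exact: ses_monic (H _).2.
Qed.

End Splice.

(** * Classifying cocycles of Yoneda extensions *)

Section Yoneda.
Variables (B : preadditive) (abB : abelian B).
Implicit Types a b c x y z w : B.

(* [g] is the degree-n component of a morphism from [P] to [E] lifting [u]. *)
Fixpoint lcompare x (P E : lseq x) (u : hom x x) n :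
    hom (P n) (E n) -> Prop :=
  match n with
  | 0 => fun g => laug E \co g = u \co laug P
  | m.+1 => fun g => exists g',
      lcompare u g' /\ lbd E m \co g = g' \co lbd P m
  end.

Lemma lcompareB x (P E : lseq x) (u v : hom x x) n (g h : hom (P n) (E n)) :
  lcompare u g -> lcompare v h -> lcompare (u - v) (g - h).
Proof.
elim: n g h => [|n IH] g h /=; first by rewrite compmBl compmBr => -> ->.
move=> [g' [ug gg]] [h' [vh hh]]; exists (g' - h'); split; first exact: IH.
by rewrite compmBr gg hh compmBl.
Qed.

Lemma lcompare_out0 x (P E : lseq x) (u : hom x x) n (g : hom (P n) (E n)) :
  lacyclic P -> lcompare u g -> lout E n \co g \co lbd P n = 0.
Proof.
move=> [_ PE]; have P0 : lout P n \co lbd P n = 0.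
  by apply: (exact_at_comp0 abB); exact: (PE n.+1).2.
case: n g P0 => [|n] g /= P0; first by move=> ->; rewrite -compmA P0 compm0.
by move=> [g' [_ ->]]; rewrite -compmA P0 compm0.
Qed.

Lemma lcompare_exists x (P E : lseq x) (u : hom x x) n :
  lacyclic P -> lexact E n -> exists g : hom (P n) (E n), lcompare u g.
Proof.
move=> PP [eE xE].
have H m : (m <= n)%N -> exists g : hom (P m) (E m), lcompare u g.
  elim: m => [_|m IH ltmn].
    by have [g gP] := PP.1 0%N _ _ (laug E) (u \co laug P) eE; exists g.
  have [g gP] := IH (ltnW ltmn).
  have [|h hP] := exact_lift abB (h := g \co lbd P m) (xE m ltmn) (PP.1 _).
    by rewrite compmA (lcompare_out0 PP gP).
  by exists h, g.
exact: H.
Qed.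

(* The difference of two lifts of the same map is a homotopy [h] up to a map
   into the kernel. *)
Lemma lcompare_homotopy x (P E : lseq x) n (g : hom (P n) (E n)) :
  lacyclic P -> lexact E n -> lcompare 0 g ->
  exists h : hom (P n) (E n), h \co lbd P n = 0 /\ lout E n \co (g - h) = 0.
Proof.
move=> PP [eE xE].
have H m : (m <= n)%N -> forall g : hom (P m) (E m), lcompare 0 g ->
    exists h : hom (P m) (E m),
      h \co lbd P m = 0 /\ lout E m \co (g - h) = 0.
  elim: m => [_|m IH ltmn] {}g /=.
    by rewrite comp0m => g0; exists 0; rewrite comp0m subr0.
  move=> [g' [/(IH (ltnW ltmn))[h [h0 gh]] gg']].
  have [t tP] := exact_lift abB (xE m ltmn) (PP.1 _) gh.
  exists (t \co lbd P m); split.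
    rewrite -compmA; have -> : lbd P m \co lbd P m.+1 = 0.
      by apply: (exact_at_comp0 abB); exact: (PP.2 m.+2).2 m.+1 _.
    by rewrite compm0.
  by rewrite compmBr gg' compmA tP compmBl h0 subr0 subrr.
exact: H.
Qed.

(* [phi] is a cocycle representing the class of [E]. *)
Definition classifies n x y (P : lseq x) (E : yext n x y)
    (phi : hom (P n.+1) y) : Prop :=
  exists g : hom (P n) (E n),
    lcompare (idm x) g /\ yinj E \co phi = g \co lbd P n.

Definition coboundary x y (P : lseq x) n (phi : hom (P n.+1) y) : Prop :=
  exists psi : hom (P n) y, phi = psi \co lbd P n.

Lemma classifies_exists n x y (P : lseq x) (E : yext n x y) :
  lacyclic P -> exists phi, classifies E phi (P := P).
Proof.
move=> PP; have [g gP] := lcompare_exists (idm x) PP (yexact E).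
have [|phi phiP] := exact_lift abB (h := g \co lbd P n) (yinj_exact E) (PP.1 _).
  by rewrite compmA (lcompare_out0 PP gP).
by exists phi, g.
Qed.

(** Two lifts of the identity differ by a map into y plus some h that vanishes on [lbd P n]; only
    the first contributes, and it gives a coboundary. *)
Lemma classifies_unique n x y (P : lseq x) (E : yext n x y) phi phi' :
  lacyclic P -> classifies E phi (P := P) -> classifies E phi' (P := P) ->
  coboundary (phi - phi').
Proof.
move=> PP [g [gP phiP]] [g' [g'P phi'P]].
have := lcompareB gP g'P; rewrite subrr.
move=> /(lcompare_homotopy PP (yexact E))[h [h0 hP]].
have [psi psiP] := exact_lift abB (yinj_exact E) (PP.1 _) hP.
exists psi; apply: (@yinj_monic _ _ _ _ E);
  rewrite compmBr phiP phi'P compmA psiP.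
by rewrite !compmBl h0 subr0.
Qed.

Lemma coboundaryB x y (P : lseq x) n (phi phi' : hom (P n.+1) y) :
  coboundary (phi - phi') -> coboundary phi' -> coboundary phi.
Proof.
move=> [u uP] [v vP]; exists (u + v).
by rewrite compmDl -uP -vP subrK.
Qed.

Lemma lcompare_map n x y (P : lseq x) (E F : yext n x y) u
    (f : forall k, hom (E k) (F k)) :
  laug F \co f 0%N = laug E ->
  (forall k, (k < n)%N -> lbd F k \co f k.+1 = f k \co lbd E k) ->
  forall k, (k <= n)%N -> forall g : hom (P k) (E k),
    lcompare u g -> lcompare u (f k \co g).
Proof.
move=> f0 fS; elim=> [_|k IH lekn] g /=; first by rewrite compmA f0.
move=> [g' [ug gg]]; exists (f k \co g'); split; first exact: IH (ltnW _) _ _.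
by rewrite compmA fS // -!compmA gg.
Qed.

Lemma classifies_map n x y (P : lseq x) (E F : yext n x y) phi :
  yext_map E F -> classifies E phi (P := P) -> classifies F phi (P := P).
Proof.
move=> [f [f0 fS fn]] [g [gP phiP]]; exists (f n \co g); split.
  exact: lcompare_map.
by rewrite -fn -!compmA phiP.
Qed.

(** Triviality of the class is invariant under zigzags. A map of extensions only pushes cocycles
    forward; to carry triviality from E to F, a cocycle of E is chosen, pushed to F and compared
    there by uniqueness. *)
Lemma coboundary_equiv n x y (P : lseq x) (E F : yext n x y) :
  lacyclic P -> yext_equiv E F ->
  (forall phi, classifies E phi (P := P) -> coboundary phi) <->
  (forall phi, classifies F phi (P := P) -> coboundary phi).
Proof.
move=> PP; elim=> {E F} [E F EF|//|E F _ IH|E F G _ IH _ IH'].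
- split=> H phi phiP; last exact: H (classifies_map EF phiP).
  have [psi psiP] := classifies_exists E PP.
  apply: coboundaryB (H psi psiP).
  exact: classifies_unique phiP (classifies_map EF psiP).
- by rewrite IH.
- by rewrite IH.
Qed.

Definition ysplice n x y k c (i : hom k c) (p : hom c x) (ip : ses i p)
    (E : yext n k y) : yext n.+1 x y.
Proof.
refine (@YExt B n.+1 x y (lsplice i p E) (yinj E : hom y (lsplice i p E n.+1)) _
  (@yinj_monic _ _ _ _ E) _).
  exact: lsplice_exact abB _ _ _ _ _ _ _ ip (yexact E).
case: n E => [|n] E; last exact: (yinj_exact E).
by apply: (exact_at_monicr abB) (yinj_exact E); exact: ses_monic ip.
Defined.

Lemma yext_retract_coboundary n x y (P : lseq x) (E : yext n x y)
    (r : hom (E n) y) :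
  r \co yinj E = idm y -> forall phi, classifies E phi (P := P) ->
    coboundary phi.
Proof.
move=> rE phi [g [_ gP]]; exists (r \co g).
by rewrite -compmA -gP compmA rE comp1m.
Qed.

(** A representative of the zero class: a biproduct in length one, and otherwise a splice through
    the zero object with the identity of x. The retraction onto y makes all its cocycles
    coboundaries. *)
Lemma yext_trivial n x y :
  exists (E : yext n x y) (r : hom (E n) y), r \co yinj E = idm y.
Proof.
elim: n x => [|n IH] x.
  have [s [i1 [i2 [p1 [p2 sP]]]]] := abelian_biproduct abB y x.
  have sx := biproduct_ses sP.
  pose L := @LSeq B x (fun=> s) (fun=> 0) p2.
  have L0 : lexact L 0 by split=> //; exact: ses_epic sx.
  have Lx : exact_at (i1 : hom y (L 0%N)) (lout L 0).
    by have /(short_exactE abB)[] := sx.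
  exists (@YExt B 0 x y L i1 L0 (ses_monic sx) Lx), p1.
  by have [] := sP.
have [z zP] := abelian_zero abB; have [E [r rE]] := IH z.
by exists (ysplice (zero_iso_ses zP (idm_iso x)) E), r.
Qed.

(** Only cocycles that come from an extension are considered, so no extension has to be built from a
    cocycle. *)
Definition all_coboundaries n x y : Prop :=
  forall (P : lseq x) (E : yext n x y) phi,
    lacyclic P -> classifies E phi (P := P) -> coboundary phi.

Lemma ext_zero_coboundaries n x y : ext_zero n.+1 x y -> all_coboundaries n x y.
Proof.
move=> H P E phi PP; have [T [r rT]] := yext_trivial n x y.
apply: (coboundary_equiv PP (H T E)).1; exact: yext_retract_coboundary rT.
Qed.

Lemma lcompare_splice x k q (i : hom k q) (p : hom q x) (P E : lseq k) n
    (g : hom (P n) (E n)) :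
  lcompare (idm k) g ->
  @lcompare x (lsplice i p P) (lsplice i p E) (idm x) n.+1 g.
Proof.
elim: n g => [|n IH] g.
  move=> /= gP; exists (idm q); split; first by rewrite comp1m compm1.
  by rewrite comp1m -compmA gP comp1m.
by move=> [g' [g'P gg']]; exists g'; split; first exact: IH.
Qed.

(** Splicing with q turns a resolution of k into one of x and an extension of k into one of x, and
    leaves the classifying cocycle unchanged. *)
Lemma coboundaries_syzygy n x y k q (i : hom k q) (p : hom q x) :
  ses i p -> projective q -> all_coboundaries n.+1 x y ->
    all_coboundaries n k y.
Proof.
move=> ip qP H P E phi PP [g [gP phiP]].
apply: (H (lsplice i p P) (ysplice ip E) phi); first exact: lsplice_acyclic.
by exists g; split; first exact: lcompare_splice.
Qed.

Lemma ysplice_map n x y k c (i : hom k c) (p : hom c x) (ip : ses i p)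
    (E F : yext n k y) :
  yext_map E F -> yext_map (ysplice ip E) (ysplice ip F).
Proof.
move=> [f [f0 fS fn]].
exists (fun m => if m is m'.+1 as m0 return
    hom (ysplice ip E m0) (ysplice ip F m0) then f m' else idm c).
split=> //=; first by rewrite compm1.
by case=> [_|m ltmn] /=; [rewrite comp1m -compmA f0 | exact: fS].
Qed.

Lemma ysplice_equiv n x y k c (i : hom k c) (p : hom c x) (ip : ses i p)
    (E F : yext n k y) :
  yext_equiv E F -> yext_equiv (ysplice ip E) (ysplice ip F).
Proof.
elim=> {E F} [E F EF|E|E F _ IH|E F G _ IH _ IH'].
- by apply: rst_step; exact: ysplice_map.
- exact: rst_refl.
- exact: rst_sym.
- exact: rst_trans IH'.
Qed.

End Yoneda.

(** * Ext^1 as splitting, and dimension shift *)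

Section ExtProjective.
Variables (B : preadditive) (abB : abelian B) (epB : enough_projectives B).
Implicit Types a b c x y z w : B.

Lemma exact_at_kerr x y z z' (f : hom x y) (g : hom y z) (g' : hom y z') :
  exact_at f g -> g' \co f = 0 ->
  (forall w (h : hom w y), g' \co h = 0 -> g \co h = 0) -> exact_at f g'.
Proof.
move=> fg g'f H; apply: (exact_by_lift abB epB) => // w h wP /H.
exact: (exact_lift abB fg wP).
Qed.

(** Lift p to a map u from q to [E 0] and pull [lbd E 0] back along u. The pullback Q maps onto k,
    the kernel of p, and replaces [E 1]; the map to E is u, then the projection a, then
    identities. *)
Lemma yext_from_splice n x y k q (i : hom k q) (p : hom q x) (ip : ses i p)
    (E : yext n.+1 x y) :
  projective q -> exists F : yext n k y, yext_map (ysplice abB ip F) E.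
Proof.
case: E => E jE lE mE jxE /= qP; have [eE xE] := lE.
have [u uP] := qP _ _ (laug E) p eE.
have [Q [a [b [ab Qpair Q0]]]] := pullback_exists abB (lbd E 0) u.
rewrite /= in a b ab Qpair Q0.
have [c cP] : exists f : hom Q k, i \co f = b.
  apply: (ses_lift ip); rewrite -uP -compmA -ab compmA.
  by rewrite (exact_at_comp0 abB (xE 0%N _)) // comp0m.
(* [E 2] belongs to the extension only when n is positive. For n = 0 the composite of the two maps
   is unknown, hence the guarded statement and the default 0. *)
have [v vP] : exists v : hom (E 2%N) Q, lbd E 0 \co lbd E 1 = 0 ->
    a \co v = lbd E 1 /\ b \co v = 0.
  have [d0|d0] := pselect (lbd E 0 \co lbd E 1 = 0); last by exists 0.
  have [|v vP] := Qpair _ (lbd E 1) (0 : hom (E 2%N) q).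
    by rewrite d0 compm0.
  by exists v.
have ec : epic c.
  apply: (epic_by_lift epB) => w t wP.
  have [|r rP] := exact_lift abB (h := u \co i \co t) (xE 0%N (ltn0Sn n)) wP.
    by rewrite /= !compmA uP (ses_comp0 ip) comp0m.
  have [|h [_ hb]] := Qpair _ r (i \co t); first by rewrite rP compmA.
  by exists h; apply: (ses_monic ip); rewrite compmA cP hb.
have c0 w (h : hom w Q) : c \co h = 0 -> b \co h = 0.
  by move=> ch; rewrite -cP -compmA ch compm0.
have exQ t (f : hom t (E 1%N)) (f' : hom t Q) :
    exact_at f (lbd E 0) -> a \co f' = f -> b \co f' = 0 -> exact_at f' c.
  move=> fx af bf; apply: (exact_by_lift abB epB).
    by apply: (monic_eq0 (ses_monic ip)); rewrite compmA cP.
  move=> w h wP /c0 bh.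
  have [|r rP] := exact_lift abB (h := a \co h) fx wP.
    by rewrite compmA ab -compmA bh compm0.
  exists r; apply/eqP; rewrite -subr_eq0; apply/eqP/Q0.
    by rewrite /= compmBr compmA af rP subrr.
  by rewrite /= compmBr compmA bf comp0m bh subr0.
pose D := @LSeq B k (fun m => if m is m'.+1 then E m'.+2 else Q)
  (fun m => match m with 0 => v | m'.+1 => lbd E m'.+2 end) c.
have vker w (h : hom w (E 2%N)) : lbd E 0 \co lbd E 1 = 0 ->
    v \co h = 0 -> lbd E 1 \co h = 0.
  by move=> /vP[<- _]; rewrite -compmA => ->; rewrite compm0.
have vker' w (h : hom w (E 2%N)) : lbd E 0 \co lbd E 1 = 0 ->
    lbd E 1 \co h = 0 -> v \co h = 0.
  by move=> /vP[av bv] h0; apply: Q0; rewrite /= compmA ?av // bv comp0m.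
have xD : lexact D n.
  split=> //; case=> [|[|m]] /= ltmn.
  - have x1 := xE 1%N ltmn; have [av bv] := vP (exact_at_comp0 abB x1).
    exact: exQ x1 av bv.
  - have x2 := xE 2%N ltmn; have d0 := exact_at_comp0 abB (xE 1%N (ltnW ltmn)).
    apply: (exact_at_kerr x2) => [|w h]; last exact: vker.
    by apply: vker' => //; exact: (exact_at_comp0 abB x2).
  - exact: (xE m.+3).
pose f m : hom (lsplice i p D m) (E m) := match m as m0 return
    hom (lsplice i p D m0) (E m0) with 0 => u | 1 => a | m'.+2 => idm _ end.
have fD m : (m < n.+1)%N -> lbd E m \co f m.+1 = f m \co lbd (lsplice i p D) m.
  case: m => [_|[|m]] /=; first by rewrite cP.
    by move=> lt1n; rewrite compm1;
      have [-> _] := vP (exact_at_comp0 abB (xE 1%N lt1n)).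
  by rewrite compm1 comp1m.
(* Only for n = 0 does y embed into the replaced term Q; its inclusion is then paired with 0 into
   q. *)
have [j [mj jx fj]] : exists j : hom y (D n),
    [/\ monic j, exact_at j (lout D n) & f n.+1 \co j = jE].
  move: jE mE jxE xE {lE xD fD}.
  rewrite /f /D; case: (n) => [|[|m]] /= j mj jx xE.
  - have [|h [ha hb]] := Qpair _ j (0 : hom y q).
      by rewrite (exact_at_comp0 abB jx) compm0.
    exists h; split=> //; last exact: exQ jx ha hb.
    apply: monicI => w t ht; apply: (monic_eq0 mj).
    by rewrite -ha -compmA ht compm0.
  - have d0 := exact_at_comp0 abB (xE 1%N (ltnSn 1)).
    exists j; split=> //; last by rewrite comp1m.
    apply: (exact_at_kerr jx) => [|w h]; last exact: vker.
    by apply: vker' => //; exact: (exact_at_comp0 abB jx).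
  - by exists j; rewrite comp1m.
exists (@YExt B n k y D j xD mj jx).
by exists f; split=> //=; rewrite uP.
Qed.

Lemma ext_zero_syzygy n x y k q (i : hom k q) (p : hom q x) :
  ses i p -> projective q -> ext_zero n.+1 k y -> ext_zero n.+2 x y.
Proof.
move=> ip qP H E F; have [E' EE] := yext_from_splice ip E qP.
have [F' FF] := yext_from_splice ip F qP.
apply: rst_trans (rst_step _ _ _ _ FF).
apply: rst_trans (ysplice_equiv abB ip (H E' F')).
by apply: rst_sym; exact: rst_step.
Qed.

Lemma splits_ext_zero x y : splits x y -> ext_zero 1 x y.
Proof.
move=> xy E F; apply: rst_step.
have yses (G : yext 0 x y) : ses (yinj G) (laug G).
  apply/(short_exactE abB); split;
    [exact: (@yinj_monic _ _ _ _ G) | exact: (yinj_exact G) |].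
  by have [] := yexact G.
have [s sP] := xy _ _ _ (yses F).
have [s' s'P] := xy _ _ _ (yses E).
have [r [rP _]] := section_retraction (yses E) s'P.
(* The splittings of E and F identify both middle terms with y + x. Degrees beyond 0 are
   irrelevant. *)
exists (fun k => match k as k0 return hom (E k0) (F k0) with
  | 0 => yinj F \co r + s \co laug E | k'.+1 => 0 end); split=> //.
  by rewrite compmDr !compmA (ses_comp0 (yses F)) sP comp0m comp1m add0r.
by rewrite compmDl -!compmA rP (ses_comp0 (yses E)) compm0 compm1 addr0.
Qed.

Lemma coboundaries_splits x y : all_coboundaries 0 x y -> splits x y.
Proof.
move=> H e j r jr.
have [P PP] := lacyclic_exists abB epB x.
pose L := @LSeq B x (fun=> e) (fun=> 0) r.
have L0 : lexact L 0 by split=> //; exact: ses_epic jr.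
have Lx : exact_at (j : hom y (L 0%N)) (lout L 0).
  by have /(short_exactE abB)[] := jr.
pose E := @YExt B 0 x y L j L0 (ses_monic jr) Lx.
have [phi phiP] := classifies_exists abB E PP.
have [psi psiP] := H P E phi PP phiP.
have [g [gP gphi]] := phiP; rewrite /= comp1m in gP.
have [k [i [q [iP eq iq]]]] : exists k i (q : hom _ k),
    [/\ is_kernel i (laug P), epic q & i \co q = lbd P 0].
  by apply/(exact_atE abB); exact: (PP.2 1%N).2 0%N _.
(* Subtracting [j \co psi] makes the lift g vanish on the first syzygy, so it descends to a section
   of r. *)
have [|s sP] := cokernel_extend (g := g - j \co psi)
    (epic_cokernel_kernel abB (PP.2 0%N).1 iP).
  apply: (epic_eq0 eq); rewrite -compmA iq compmBl -gphi psiP -compmA.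
  by rewrite subrr.
exists s; apply: (PP.2 0%N).1; rewrite -compmA sP compmBr gP compmA.
by rewrite (ses_comp0 jr) comp0m subr0 comp1m.
Qed.

Lemma ext_zero1E x y : ext_zero 1 x y <-> splits x y.
Proof.
split; last exact: splits_ext_zero.
by move=> /(ext_zero_coboundaries abB); exact: coboundaries_splits.
Qed.

Lemma coboundaries_ext_zero n x y : all_coboundaries n x y -> ext_zero n.+1 x y.
Proof.
elim: n x => [|n IH] x H.
  by apply/splits_ext_zero; exact: coboundaries_splits.
have [q [p [qP pe]]] := epB x; have [k [i ip]] := epic_ses abB pe.
apply: (ext_zero_syzygy ip qP); apply: IH.
exact: coboundaries_syzygy ip qP H.
Qed.

Lemma ext_zeroS n x y k q (i : hom k q) (p : hom q x) :
  ses i p -> projective q -> ext_zero n.+2 x y <-> ext_zero n.+1 k y.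
Proof.
move=> ip qP; split; last exact: ext_zero_syzygy ip qP.
move=> /(ext_zero_coboundaries abB)/(coboundaries_syzygy abB ip qP).
exact: coboundaries_ext_zero.
Qed.

End ExtProjective.

(** * Long exact sequences for the vanishing of Ext *)

Section LongExact.
Variables (B : preadditive) (abB : abelian B) (epB : enough_projectives B).
Implicit Types a b c x y z w : B.

Definition ext_all x y : Prop := forall n, ext_zero n.+1 x y.

Lemma ext_all_splits x y : ext_all x y -> splits x y.
Proof. by move=> H; apply/(ext_zero1E abB epB); exact: H. Qed.

Lemma projective_cover x :
  exists q k (i : hom k q) (p : hom q x), projective q /\ ses i p.
Proof.
have [q [p [qP pe]]] := epB x; have [k [i ip]] := epic_ses abB pe.
by exists q, k, i, p.
Qed.

Lemma ext_all_syzygy x y k q (i : hom k q) (p : hom q x) :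
  ses i p -> projective q -> ext_all x y -> ext_all k y.
Proof. by move=> ip qP H n; apply/(ext_zeroS abB epB _ _ ip qP); exact: H. Qed.

(** In degree 1, a map from the syzygy k to c lifts to b since Ext^1(k, a) = 0, and the lift extends
    to q since Ext^1(x, b) = 0. Higher degrees follow by dimension shift. *)
Lemma ext_all_cokernel x a b c (f : hom a b) (g : hom b c) :
  ses f g -> ext_all x a -> ext_all x b -> ext_all x c.
Proof.
move=> fg xa xb n; elim: n x xa xb => [|n IH] x xa xb.
all: have [q [k [i [p [qP ip]]]]] := projective_cover x.
all: have ka := ext_all_syzygy ip qP xa.
  apply/(ext_zero1E abB epB).
  apply: (splits_quotient abB ip (projective_splits qP)) => u.
  have [v vP] := splits_lift abB u fg (ext_all_splits ka).
  have [h hP] := splits_extend abB v ip (ext_all_splits xb).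
  by exists (g \co h); rewrite -compmA hP.
apply/(ext_zeroS abB epB _ _ ip qP); apply: IH => //.
exact: ext_all_syzygy ip qP xb.
Qed.

(* Rotation of the exact sequence [a -> b -> c] in the derived category. *)
Lemma ses_rotate a b c kb q (f : hom a b) (g : hom b c) (i : hom kb q)
    (p : hom q b) :
  ses f g -> ses i p -> exists kc (j : hom kc q) (m : hom kb kc) (r : hom kc a),
    [/\ ses j (g \co p), ses m r & j \co m = i].
Proof.
move=> fg ip.
have [kc [j jP]] := epic_ses abB (epic_comp (ses_epic fg) (ses_epic ip)).
have [|m mP] := ses_lift (h := i) jP.
  by rewrite -compmA (ses_comp0 ip) compm0.
have [|r rP] := ses_lift (h := p \co j) fg;
  first by rewrite compmA (ses_comp0 jP).
exists kc, j, m, r; split=> //.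
have mr : is_kernel m r.
  apply: kernelI.
  - apply: (monic_eq0 (ses_monic fg)).
    by rewrite compmA rP -compmA mP (ses_comp0 ip).
  - apply: monicI => w h mh; apply: (monic_eq0 (ses_monic ip)).
    by rewrite -mP -compmA mh compm0.
  - move=> w t rt; have [|s sP] := ses_lift (h := j \co t) ip.
      by rewrite compmA -rP -compmA rt compm0.
    by exists s; apply: (ses_monic jP); rewrite compmA mP.
split=> //; apply: (epic_cokernel_kernel abB _ mr).
apply: (epic_by_lift epB) => w h wP.
have [t tP] := wP _ _ p (f \co h) (ses_epic ip).
have [|s sP] := ses_lift (h := t) jP.
  by rewrite -compmA tP compmA (ses_comp0 fg) comp0m.
by exists s; apply: (ses_monic fg); rewrite compmA rP -compmA sP.
Qed.

(** The two claims feed each other: one rotation turns the extension claim into the kernel claim one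
    degree lower, and two rotations turn the kernel claim into the extension claim one degree
    lower. *)
Lemma ext_zero_extension_kernel y n :
  (forall a b c (f : hom a b) (g : hom b c), ses f g ->
     ext_zero n.+1 a y -> ext_zero n.+1 c y -> ext_zero n.+1 b y) /\
  (forall a b c (f : hom a b) (g : hom b c), ses f g ->
     ext_zero n.+1 b y -> ext_zero n.+2 c y -> ext_zero n.+1 a y).
Proof.
elim: n => [|n [IHe IHk]]; split=> a b c f g fg;
  have [q [kb [i [p [qP ip]]]]] := projective_cover b;
  have [kc [j [m [r [jgp mr jm]]]]] := ses_rotate fg ip.
- move=> /(ext_zero1E abB epB) ay /(ext_zero1E abB epB) cy.
  apply/(ext_zero1E abB epB).
  apply: (splits_quotient abB ip (projective_splits qP)) => u.
  have [v vP] := splits_extend abB u mr ay.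
  have [h hP] := splits_extend abB v jgp cy.
  by exists h; rewrite -jm compmA hP.
- move=> /(ext_zero1E abB epB) bY /(ext_zeroS abB epB _ _ jgp qP).
  move=> /(ext_zero1E abB epB) ky; apply/(ext_zero1E abB epB).
  apply: (splits_quotient abB mr ky) => u.
  have [v vP] := splits_extend abB u ip bY.
  by exists (v \co j); rewrite -compmA jm.
- move=> ay /(ext_zeroS abB epB _ _ jgp qP) ky.
  by apply/(ext_zeroS abB epB _ _ ip qP); exact: IHk mr ky ay.
- move=> /(ext_zeroS abB epB _ _ ip qP) kby /(ext_zeroS abB epB _ _ jgp qP) kcy.
  have [q' [k' [i' [p' [q'P ip']]]]] := projective_cover kc.
  have [k'' [j' [m' [r' [jgp' mr' _]]]]] := ses_rotate mr ip'.
  apply/(ext_zeroS abB epB _ _ jgp' q'P); apply: IHe mr' _ kby.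
  exact/(ext_zeroS abB epB _ _ ip' q'P).
Qed.

Lemma ext_all_kernel y a b c (f : hom a b) (g : hom b c) :
  ses f g -> ext_all b y -> ext_all c y -> ext_all a y.
Proof.
move=> fg b_y c_y n; apply: (ext_zero_extension_kernel y n).2 fg _ _.
  exact: b_y.
exact: c_y.
Qed.

End LongExact.

(** * Balanced pairs from finite balanced systems *)

(* Inductive forms of [wedge] and, in [opc B], of [vee]. *)
Inductive iwedge (B : preadditive) (C : B -> Prop) : B -> Prop :=
| iwedge_iso (c x : B) (f : hom c x) : is_iso f -> C c -> iwedge C x
| iwedge_ses (k c x : B) (i : hom k c) (p : hom c x) :
    ses i p -> C c -> iwedge C k -> iwedge C x.

Definition ivee (B : preadditive) (C : B -> Prop) (x : B) : Prop :=
  @iwedge (opc B) C x.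

(** * Inductive description of finite resolutions *)

Section Wedge.
Variables (B : preadditive) (abB : abelian B).
Implicit Types (a b c x y z w : B) (C D : B -> Prop).

Lemma iwedge_base C x : C x -> iwedge C x.
Proof. exact: (iwedge_iso (idm_iso x)). Qed.

Lemma iwedgeP C x : wedge C x <-> iwedge C x.
Proof.
split=> [[E [n]]|].
  elim: n x E => [|n IH] x E [CE [eE xE] mE].
    by apply: (@iwedge_iso _ _ (E 0%N) _ (laug E));
      [exact: monic_epic_iso | exact: CE].
  have [k [i [e [iP ee ie]]]] : exists k i (e : hom _ k),
      [/\ is_kernel i (laug E), epic e & i \co e = lbd E 0].
    by apply/(exact_atE abB); exact: (xE 0%N).
  have ip : ses i (laug E) by split=> //; exact: epic_cokernel_kernel.
  apply: (iwedge_ses ip); first exact: CE.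
  have mi := ses_monic ip.
  (* As i is monic, e and [lbd E 0] kill the same maps, so exactness passes to the sequence
     truncated at k. *)
  have kere w (h : hom w _) : e \co h = 0 <-> lbd E 0 \co h = 0.
    rewrite -ie -compmA; split=> [->|/(monic_eq0 mi)//]; exact: compm0.
  apply: (IH _ (@LSeq B k (fun m => E m.+1) (fun m => lbd E m.+1) e)); split.
  - by move=> m lemn; exact: CE.
  - split=> //; case=> [|m] ltmn; last exact: (xE m.+2).
    have /(exact_atE abB)[l [j [d [jP de jd]]]] := xE 1%N ltmn.
    apply/(exact_atE abB); exists l, j, d; split=> //=.
    apply: kernelI; [exact/kere/(kernel_comp0 jP) | exact: kernel_monic jP |].
    by move=> w h /kere; exact: kernel_lift.
  - case: n {IH} mE xE CE => [|n] mE xE CE; last exact: mE.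
    by apply: monicI => w h /kere; exact: monic_eq0.
elim=> {x} [c x f fi Cc|k c x i p ip Cc _ [E [n [CE lE mE]]]].
  exists (@LSeq B x (fun=> c) (fun=> 0) f), 0%N.
  by split=> //; [split=> //; exact: iso_epic fi | exact: iso_monic fi].
exists (lsplice i p E), n.+1; split; first by case=> [|m] //=; exact: CE.
  exact: lsplice_exact.
case: n E CE lE mE => [|n] E CE lE mE; last exact: mE.
by apply: monic_comp; [exact: ses_monic ip | exact: mE].
Qed.

End Wedge.

Section Vee.
Variables (B : preadditive) (abB : abelian B).
Let abB' := op_abelian abB.
Implicit Types (x : B) (C : B -> Prop).

Definition op_lseq x (E : rseq x) : @lseq (opc B) x :=
  @LSeq (opc B) x (rterm E) (rbd E) (raug E).

Definition op_rseq x (E : @lseq (opc B) x) : rseq x :=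
  @RSeq B x (@lterm (opc B) x E) (@lbd (opc B) x E) (@laug (opc B) x E).

Lemma iveeP C x : vee C x <-> ivee C x.
Proof.
rewrite /ivee -(iwedgeP abB'); split=> -[E [n [CE [mE xE] eE]]].
  exists (op_lseq E), n; split=> //.
  split=> // k ltkn; have := exact_at_op abB (xE k ltkn).
  by case: k {ltkn} => [|k] xk; exact: xk.
exists (op_rseq E), n; split=> //.
split=> // k ltkn; have := exact_at_op abB' (xE k ltkn).
by case: k {ltkn} => [|k] xk; exact: xk.
Qed.

End Vee.

(** * Proper resolutions from approximations *)

Section LeftBalance.
Variables (B : preadditive) (abB : abelian B) (X W V Y : B -> Prop).
Hypotheses (pX : pointed X) (eX : extension_closed X).
Hypotheses (WX : rel_cogenerator W X) (VY : rel_generator V Y).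
Hypothesis splXW : forall x k, X x -> iwedge W k -> splits x k.
Hypothesis splWY : forall k y, iwedge W k -> Y y -> splits k y.
Hypothesis splXV : forall x v, iwedge X x -> V v -> splits x v.

(* The approximation of Auslander and Buchweitz. *)
Lemma wedge_approximation x : iwedge X x ->
  exists k z (i : hom k z) (p : hom z x), [/\ ses i p, X z & iwedge W k].
Proof.
elim=> {x} [c x f fi Xc|m c x i p ip Xc _ [k [z [j [q [jq Xz Wk]]]]]].
  (* No zero object of W is at hand to serve as kernel; a cogenerator w of the zero object is used,
     with w + c as the middle term. *)
  have [o [_ Xo]] := pX; have [w [_ [_ [_ [_ Ww _]]]]] := WX.2 o Xo.
  have [s [i1 [i2 [p1 [p2 sP]]]]] := abelian_biproduct abB w c.
  have ws := biproduct_ses sP; exists w, s, i1, (f \co p2); split.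
  - split; first by apply: kernel_monic_comp ws.1; exact: iso_monic.
    apply: (epic_cokernel_kernel abB).
      by apply: epic_comp (ses_epic ws); exact: iso_epic.
    by apply: kernel_monic_comp ws.1; exact: iso_monic.
  - by apply: eX Xc; [exact/(short_exactE abB)/ws | exact: WX.1].
  - exact: iwedge_base.
(* Embed z into w with cokernel z'. The pushout h of w along q is a quotient of w by k, hence in
   W^wedge, and it contains m with cokernel z'. Pushing c out along m -> h gives t, an extension of
   z' by c, hence in X, and t maps onto x with kernel h. *)
have [w [z' [f [g [/(short_exactE abB) fg Ww Xz']]]]] := WX.2 z Xz.
have [h [q' [f' po]]] := pushout_exists abB f q.
have [g' [_ fg']] := ses_pushout abB fg po.
have kwh := ses_pushout_epic abB po (ses_monic fg) jq.
have Wh : iwedge W h := iwedge_ses kwh Ww Wk.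
have [t [f'' [i' po']]] := pushout_exists abB i f'.
have [p' [_ ip']] := ses_pushout abB ip po'.
have [g'' [_ fg'']] := ses_pushout abB fg' (pushout_sym po').
exists h, t, i', p'; split=> //.
by apply: eX Xc Xz'; exact/(short_exactE abB)/fg''.
Qed.

Definition good x := exists E : lseq x,
  [/\ proper_left_resolution X E & lseq_contra_acyclic Y E].

Lemma good_zero z : is_zero z -> good z.
Proof.
move=> [zt zi]; have [o [[ot oi] Xo]] := pX.
exists (@LSeq B z (fun=> o) (fun=> 0) 0); split; first split.
- by split=> // -[|k]; rewrite /= compm0.
- move=> w _; split=> [f|k v]; first by exists 0; rewrite [f]zt compm0.
  by split=> [_|[u <-]]; [exists 0;
    rewrite compm0 (ot _ v) | rewrite /= comp0m compm0].
- move=> w _; split=> [f _|k v]; first exact: zi.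
  by split=> [_|_]; [exists 0; rewrite comp0m (oi _ v) | rewrite /= compm0].
Qed.

(** The last two hypotheses are what exactness needs where the sequences are joined: lifting through
    p for Hom(X, -), and extending along i for Hom(-, Y). *)
Lemma good_splice k c x (i : hom k c) (p : hom c x) :
  ses i p -> X c -> good k ->
  (forall w (t : hom w x), X w -> exists h, p \co h = t) ->
  (forall y (u : hom k y), Y y -> exists h, h \co i = u) -> good x.
Proof.
move=> ip Xc [E [[[E0 XE] covE] conE]] lft ext.
have mi := ses_monic ip; have p0 := ses_comp0 ip.
exists (lsplice i p E); split; first split.
- split; case=> [|[|m]] //=.
  + by rewrite compmA p0 comp0m.
  + by rewrite -compmA (E0 0%N) compm0.
- move=> w Xw; have [srj exa] := covE w Xw; split=> [t|]; first exact: lft.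
  case=> [|[|m]] v /=.
  + split=> [/(ses_lift ip)[h <-]|[u <-]]; last by rewrite !compmA p0 !comp0m.
    by have [u <-] := srj h; exists u; rewrite compmA.
  + rewrite -(exa 0%N) /= -compmA; split=> [/(monic_eq0 mi)//|->];
      exact: compm0.
  + exact: (exa m.+1).
- move=> y Yy; have [inj exa] := conE y Yy; split=> [f|].
    exact: (epic_eq0 (ses_epic ip)).
  case=> [|[|m]] v /=.
  + split=> [|[u <-]]; last by rewrite -compmA (compmA p) p0 comp0m compm0.
    by rewrite compmA => /inj/(ses_extend ip).
  + rewrite (exa 0%N) /=; split=> -[u <-]; last by exists (u \co i);
      rewrite compmA.
    by have [h <-] := ext _ u Yy; exists h; rewrite compmA.
  + exact: (exa m.+1).
Qed.

Lemma good_iwedge_cogenerator x : iwedge W x -> good x.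
Proof.
elim=> {x} [c x f fi Wc|k c x i p ip Wc Wk IH].
  have [z zP] := abelian_zero abB.
  apply: (good_splice (zero_iso_ses zP fi)); first exact: WX.1.
  - exact: good_zero.
  - move=> w t _; have [g [_ fg]] := fi; exists (g \co t).
    by rewrite compmA fg comp1m.
  - by move=> y u _; exists 0; rewrite comp0m (zP.2 _ u).
apply: (good_splice ip) => //; first exact: WX.1.
- by move=> w t Xw; apply: (splits_lift abB t ip); exact: splXW.
- move=> y u Yy; apply: (splits_extend abB u ip).
  by apply: splWY => //; exact: iwedge_ses ip Wc Wk.
Qed.

Lemma good_iwedge x : iwedge X x -> good x.
Proof.
move=> Xx; have [k [z [i [p [ip Xz Wk]]]]] := wedge_approximation Xx.
apply: (good_splice ip) => //; first exact: good_iwedge_cogenerator.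
  by move=> w t Xw; apply: (splits_lift abB t ip); exact: splXW.
move=> y u Yy.
have [v [y' [f [g [/(short_exactE abB) fg Vv Yy']]]]] := VY.2 y Yy.
have [u' u'P] := splits_lift abB u fg (splWY Wk Yy').
have [h hP] := splits_extend abB u' ip (splXV Xx Vv).
by exists (g \co h); rewrite -compmA hP.
Qed.

End LeftBalance.

(** * Balanced systems in the opposite category *)

Section OpClasses.
Variables (B : preadditive) (abB : abelian B).
Let abB' := op_abelian abB.
Implicit Types C D : B -> Prop.

Lemma op_short_exact (x y z : B) (f : hom x y) (g : hom y z) :
  short_exact f g <-> @short_exact (opc B) z y x g f.
Proof.
rewrite (short_exactE abB) (short_exactE abB'); split; first exact: op_ses.
by case.
Qed.

Lemma op_pointed C : pointed C -> @pointed (opc B) C.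
Proof. by move=> [z [[z1 z2] Cz]]; exists z. Qed.

Lemma op_extension_closed C : extension_closed C -> @extension_closed (opc B) C.
Proof.
by move=> eC x y z f g /op_short_exact fg Cx Cz; exact: eC fg Cz Cx.
Qed.

Lemma op_rel_cogenerator D C :
  rel_generator D C -> @rel_cogenerator (opc B) D C.
Proof.
move=> [DC gen]; split=> // y /gen[v [y' [f [g [fg Dv Cy']]]]].
by exists v, y', g, f; split=> //; exact/op_short_exact.
Qed.

Lemma op_rel_generator D C :
  rel_cogenerator D C -> @rel_generator (opc B) D C.
Proof.
move=> [DC gen]; split=> // y /gen[v [y' [f [g [fg Dv Cy']]]]].
by exists v, y', g, f; split=> //; exact/op_short_exact.
Qed.

Lemma op_good (X Y : B -> Prop) (y : B) : @good (opc B) Y X y ->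
  exists E : rseq y, proper_right_resolution Y E /\ rseq_cov_acyclic X E.
Proof.
move=> [E [[[E0 YE] covE] conE]]; exists (op_rseq E); split; first split.
- by split.
- by move=> w Yw; have [srj exa] := covE w Yw; split.
- by move=> w Xw; have [inj exa] := conE w Xw; split.
Qed.

End OpClasses.

Section Balance.
Variables (B : preadditive) (abB : abelian B) (epB : enough_projectives B).
Let abB' := op_abelian abB.
Implicit Types (x y z : B) (C D : B -> Prop).

Lemma ext_all_zeror x z : is_zero z -> ext_all x z.
Proof.
move=> [_ zi] n; elim: n x => [|n IH] x.
  apply/(ext_zero1E abB epB) => e j p jp.
  have [|s sP] := ses_extend (h := idm e) jp; first by rewrite comp1m;
    exact: zi.
  by exists s; apply: (ses_epic jp); rewrite -compmA sP compm1 comp1m.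
have [q [k [i [p [qP ip]]]]] := projective_cover abB epB x.
by apply/(ext_zeroS abB epB _ _ ip qP); exact: IH.
Qed.

Lemma ext_all_zerol z y : is_zero z -> ext_all z y.
Proof.
move=> zP; elim=> [|n IH].
  apply/(ext_zero1E abB epB) => e j p jp.
  by exists 0; rewrite (zP.1 _ (idm z)) compm0.
have Pz : projective z.
  by move=> u v e f _; exists 0; rewrite compm0 (zP.2 _ f).
exact/(ext_zeroS abB epB _ _ (zero_iso_ses zP (idm_iso z)) Pz).
Qed.

Lemma ext_all_iwedge C x k : 
  (forall c, C c -> ext_all x c) -> iwedge C k -> ext_all x k.
Proof.
move=> xC; elim=> {k} [c k f fi /xC xc|k c y i p ip /xC xc _ xk]; last first.
  exact (ext_all_cokernel abB epB ip xk xc).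
have [z zP] := abelian_zero abB.
exact (ext_all_cokernel abB epB (zero_iso_ses zP fi)
  (@ext_all_zeror x z zP) xc).
Qed.

(** Ext stays in B here: the coresolution is read as a chain of kernels, and the long exact sequence
    in the first variable is applied. *)
Lemma ext_all_ivee C k y :
  (forall c, C c -> ext_all c y) -> ivee C k -> ext_all k y.
Proof.
move=> Cy; elim=> {k} [c k f [g [gf fg]] /Cy cy|k c x i p ip /Cy cy _ ky].
  have [z zP] := abelian_zero abB.
  have fi : @is_iso (opc B) c k f by exists g.
  have zP' : @is_zero (opc B) z by case: zP.
  have zk := @zero_iso_ses (opc B) z c k f zP' fi.
  exact (ext_all_kernel abB epB (op_ses zk) cy (@ext_all_zerol z y zP)).
exact (ext_all_kernel abB epB (op_ses ip) cy ky).
Qed.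

Lemma finite_balanced_system_balanced_pair (X W V Y : B -> Prop) :
  finite_balanced_system X W V Y -> balanced_pair X Y (wedge X) (vee Y).
Proof.
case=> [[pX eX] [pY eY] [WX XW] [VY YV] [XwV WwY] [WYv XVv]].
have left x : iwedge X x -> good X Y x.
  apply: (@good_iwedge _ abB X W V Y) => //.
  - move=> {}x k Xx Wk; apply: (ext_all_splits abB epB).
    by apply: ext_all_iwedge Wk => c Wc n; exact: (XW n.+1).
  - by move=> k y /(iwedgeP abB) Wk Yy; apply/(ext_zero1E abB epB)/WwY.
  - by move=> {}x v /(iwedgeP abB) Xx Vv; apply/(ext_zero1E abB epB)/XwV.
(* In [opc B] the roles are exchanged: V is a cogenerator in Y and W a generator in X. Each Ext
   condition is turned into [splits] in B and then dualized. *)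
have right y : ivee Y y -> @good (opc B) Y X y.
  apply: (@good_iwedge _ abB' Y V W X).
  - exact: op_pointed.
  - exact: op_extension_closed.
  - exact: op_rel_cogenerator.
  - exact: op_rel_generator.
  - move=> {}y k Yy Vk; apply: op_splits; apply: (ext_all_splits abB epB).
    by apply: ext_all_ivee Vk => c Vc n; exact: (YV n.+1).
  - move=> k x /(iveeP abB) Vk Xx; apply: op_splits.
    by apply/(ext_zero1E abB epB)/XVv.
  - move=> {}y w /(iveeP abB) Yy Ww; apply: op_splits.
    by apply/(ext_zero1E abB epB)/WYv.
split.
- split=> x; first by move=> Xx; apply/(iwedgeP abB)/iwedge_base.
  by move=> /(iwedgeP abB)/left[E [EP _]]; exists E.
- split=> y; first by move=> Yy; apply/(iveeP abB)/iwedge_base.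
  by move=> /(iveeP abB)/right/op_good[E [EP _]]; exists E.
- by move=> x /(iwedgeP abB)/left[E [EP EC]]; exists E.
- by move=> y /(iveeP abB)/right/op_good.
Qed.

End Balance.

(** * Complexes *)

Section ChTerms.
Variables (A : preadditive) (abA : abelian A).
Implicit Types X Y Z K : Ch A.

Lemma cmap_compE X Y Z (g : hom Y Z) (f : hom X Y) m :
  cmap (g \co f) m = cmap g m \co cmap f m.
Proof. by []. Qed.

Lemma ch_iso_term X Y (f : hom X Y) m : is_iso f -> is_iso (cmap f m).
Proof.
move=> [g [gf fg]]; exists (cmap g m).
by split; [rewrite -(cmap_compE g f) gf | rewrite -(cmap_compE f g) fg].
Qed.

Lemma ch_epic_by_term X Y (f : hom X Y) : (forall m, epic (cmap f m)) -> epic f.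
Proof.
move=> ef Z g h e; apply: chain_mapP => m; apply: (ef m).
exact: (congr1 (fun u : chain_map X Z => u m) e).
Qed.

Lemma ch_monic_by_term X Y (f : hom X Y) :
  (forall m, monic (cmap f m)) -> monic f.
Proof.
move=> mf Z g h e; apply: chain_mapP => m; apply: (mf m).
exact: (congr1 (fun u : chain_map Z Y => u m) e).
Qed.

(** f is isomorphic to the kernel of g that is computed degreewise. *)
Lemma ch_ses_term X Y Z (f : hom X Y) (g : hom Y Z) :
  ses f g -> forall m, ses (cmap f m) (cmap g m).
Proof.
move=> fg m; have [K [i iP]] := ch_kernel abA g.
have [u [ui uf]] := kernel_iso (ch_is_kernel iP) fg.1.
have fm : is_kernel (cmap f m) (cmap g m).
  by rewrite -uf cmap_compE; apply: kernel_comp_iso (iP m) _;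
    exact: ch_iso_term.
split=> //; apply: (epic_cokernel_kernel abA _ fm).
exact: (ch_epic abA (ses_epic fg)).
Qed.

End ChTerms.

(** * The Hom complex and contractibility *)

Section HomComplex.
Variable A : preadditive.
Implicit Types X Y Z N : Ch A.

Definition hfam X Y := forall i j, hom (cterm X i) (cterm Y j).

(* All degrees of the complex Hom(X, Y) at once: the usual differential is
   [hdiff] up to signs, [e] being the parity of the degree. *)
Definition hdiff X Y (e : bool) (F : hfam X Y) : hfam X Y := fun i j =>
  let u := F (i - 1) j \co cdiff X i (i - 1) in
  cdiff Y (j + 1) j \co F i (j + 1) + if e then - u else u.

(** [hdiff] respects the degree j - i, so a family is a product of independent homogeneous parts.
    Multiplying [F i j] by (-1)^i exchanges the two parities, so asking for both amounts to
    acyclicity of the usual complex. *)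
Definition hacyclic X Y : Prop := forall e (F : hfam X Y),
  (forall i j, hdiff e F i j = 0) ->
  exists S : hfam X Y, forall i j, F i j = hdiff (~~ e) S i j.

Lemma hdiffB X Y e (F G : hfam X Y) i j :
  hdiff e (fun a b => F a b - G a b) i j = hdiff e F i j - hdiff e G i j.
Proof.
by rewrite /hdiff compmBr compmBl; case: e; rewrite !opprD addrACA.
Qed.

Lemma hdiff_hdiff X Y e (F : hfam X Y) i j :
  hdiff e (hdiff (~~ e) F) i j = 0.
Proof.
rewrite /hdiff; case: e => /=;
  rewrite compmDl compmDr ?compNm ?compmN !compmA !cdiff_cdiff ?comp0m ?add0r;
  rewrite -?(compmA (F _ _)) cdiff_cdiff compm0.
  by rewrite addr0 subrr.
by rewrite subr0 addNr.
Qed.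

Lemma hdiff_comp X X' Y e (F : hfam X Y) (g : hom X' X) i j :
  hdiff e (fun a b => F a b \co cmap g a) i j = hdiff e F i j \co cmap g i.
Proof.
rewrite /hdiff compmDl compmA -(compmA (F _ _)) -cmap_comm compmA.
by case: e; rewrite /= ?compNm.
Qed.

Lemma comp_hdiff X Y Y' e (F : hfam X Y) (g : hom Y Y') i j :
  hdiff e (fun a b => cmap g b \co F a b) i j = cmap g j \co hdiff e F i j.
Proof.
rewrite /hdiff compmDr compmA cmap_comm -!compmA.
by case: e; rewrite /= ?compmN.
Qed.

Definition contractible X : Prop := exists h : hfam X X, forall i,
  cdiff X (i + 1) i \co h i (i + 1) + h (i - 1) i \co cdiff X i (i - 1) = idm _.

Lemma contractible_iso X Y (f : hom X Y) :
  is_iso f -> contractible X -> contractible Y.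
Proof.
move=> [g [gf fg]] [h hP].
exists (fun i j => cmap f j \co h i j \co cmap g i) => i.
have -> : idm (cterm Y i) = cmap f i \co (idm _) \co cmap g i.
  by rewrite compm1 -(cmap_compE f g) fg.
rewrite -hP compmDr compmDl !compmA cmap_comm; congr (_ + _).
by rewrite -!compmA cmap_comm.
Qed.

(** Composing a cocycle with the contraction h gives a primitive up to sign: the cocycle condition
    moves the differential of Y across F, which leaves F(dh + hd) = F. *)
Lemma contractible_hacyclic_l X Y : contractible X -> hacyclic X Y.
Proof.
move=> [h hP] e F F0.
pose S0 : hfam X Y := fun i j => F (i + 1) j \co h i (i + 1).
exists (fun i j => if e then S0 i j else - S0 i j) => i j.
have H : cdiff Y (j + 1) j \co S0 i (j + 1) =
    if e then F i j \co (cdiff X (i + 1) i \co h i (i + 1))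
    else - (F i j \co (cdiff X (i + 1) i \co h i (i + 1))).
  rewrite /S0 compmA; have := F0 (i + 1) j; rewrite /hdiff addrK => /eqP.
  rewrite addr_eq0 => /eqP ->.
  by case: e {F0}; rewrite ?opprK ?compNm !compmA.
have H' : S0 (i - 1) j \co cdiff X i (i - 1) =
    F i j \co (h (i - 1) i \co cdiff X i (i - 1)).
  by rewrite /S0 subrK compmA.
rewrite /hdiff; case: e H {F0} => /= H.
  by rewrite H H' -compmDr hP compm1.
by rewrite compmN compNm H H' !opprK -compmDr hP compm1.
Qed.

Lemma contractible_hacyclic_r X Y : contractible Y -> hacyclic X Y.
Proof.
move=> [h hP] e F F0.
exists (fun i j => h (j - 1) j \co F i (j - 1)) => i j.
rewrite /hdiff addrK -compmA.
have -> : (if ~~ e then - (h (j - 1) j \co (F (i - 1)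
  (j - 1) \co cdiff X i (i - 1)))
    else h (j - 1) j \co (F (i - 1) (j - 1) \co cdiff X i (i - 1))) =
    h (j - 1) j \co (cdiff Y j (j - 1) \co F i j).
  have := F0 i (j - 1); rewrite /hdiff subrK => /eqP.
  rewrite addr_eq0 => /eqP ->.
  by case: e {F0} => /=; rewrite ?opprK ?compmN.
by rewrite !compmA -compmDl hP comp1m.
Qed.

Variable abA : abelian A.

Lemma hfam_splits_extend X X' N Y (i : hom X X') (p : hom X' N) (F : hfam X Y) :
  ses i p -> (forall a b, splits (cterm N a) (cterm Y b)) ->
  exists F' : hfam X' Y, forall a b, F' a b \co cmap i a = F a b.
Proof.
move=> ip NY; have H a b : exists h, h \co cmap i a = F a b.
  exact: (splits_extend abA _ (ch_ses_term abA ip a) (NY a b)).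
by exists (fun a b => sval (cid (H a b))) => a b; case: cid.
Qed.

Lemma hfam_splits_lift X N Y Y' (i : hom N Y) (p : hom Y Y') (F : hfam X Y') :
  ses i p -> (forall a b, splits (cterm X a) (cterm N b)) ->
  exists F' : hfam X Y, forall a b, cmap p b \co F' a b = F a b.
Proof.
move=> ip XN; have H a b : exists h, cmap p b \co h = F a b.
  exact: (splits_lift abA _ (ch_ses_term abA ip b) (XN a b)).
by exists (fun a b => sval (cid (H a b))) => a b; case: cid.
Qed.

Lemma hfam_extend X X' N Y (i : hom X X') (p : hom X' N) (F : hfam X' Y) :
  ses i p -> (forall a b, F a b \co cmap i a = 0) ->
  exists F' : hfam N Y, forall a b, F' a b \co cmap p a = F a b.
Proof.
move=> ip F0; have H a b : exists h, h \co cmap p a = F a b.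
  exact: (ses_extend (ch_ses_term abA ip a)).
by exists (fun a b => sval (cid (H a b))) => a b; case: cid.
Qed.

Lemma hfam_lift X N Y Y' (i : hom N Y) (p : hom Y Y') (F : hfam X Y) :
  ses i p -> (forall a b, cmap p b \co F a b = 0) ->
  exists F' : hfam X N, forall a b, cmap i b \co F' a b = F a b.
Proof.
move=> ip F0; have H a b : exists h, cmap i b \co h = F a b.
  exact: (ses_lift (ch_ses_term abA ip b)).
by exists (fun a b => sval (cid (H a b))) => a b; case: cid.
Qed.

Lemma hdiff_ext X Y e (F G : hfam X Y) :
  (forall i j, F i j = G i j) -> forall i j, hdiff e F i j = hdiff e G i j.
Proof. by move=> FG i j; rewrite /hdiff !FG. Qed.

Section TwoOutOfThree.
Variables (X0 X1 X2 : Ch A) (i : hom X0 X1) (p : hom X1 X2).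
Hypothesis ip : ses i p.
Let sip := ch_ses_term abA ip.

(** Splitting makes Hom(X1, Y) -> Hom(X0, Y) surjective in each degree. A primitive S of [F p]
    restricts to a cocycle on X0; extending a primitive of that to X1 and subtracting its
    differential makes S descend to X2. *)
Lemma hacyclic_cokernel_l Y :
  (forall a b, splits (cterm X2 a) (cterm Y b)) ->
  hacyclic X0 Y -> hacyclic X1 Y -> hacyclic X2 Y.
Proof.
move=> spl a0 a1 e F F0.
have [a b|S SP] := a1 e (fun a b => F a b \co cmap p a).
  by rewrite hdiff_comp F0 comp0m.
have [a b|T TP] := a0 (~~ e) (fun a b => S a b \co cmap i a).
  by rewrite hdiff_comp -SP -compmA (ses_comp0 (sip a)) compm0.
have [T' T'P] := hfam_splits_extend T ip spl.
pose S' : hfam X1 Y := fun a b => S a b - hdiff (~~ ~~ e) T' a b.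
have [a b|S'' S''P] := hfam_extend (F := S') ip.
  rewrite /S' compmBl TP -hdiff_comp.
  by rewrite (hdiff_ext (~~ ~~ e) (G := T)) ?subrr.
exists S'' => a b; apply: (ses_epic (sip a)); rewrite SP -hdiff_comp.
by rewrite (hdiff_ext _ S''P) hdiffB hdiff_hdiff subr0.
Qed.

(** The connecting map: F extends degreewise to X1, and the differential of the extension descends
    to a cocycle on X2, whose primitive corrects the extension to a cocycle. *)
Lemma hacyclic_kernel_l Y :
  (forall a b, splits (cterm X2 a) (cterm Y b)) ->
  hacyclic X1 Y -> hacyclic X2 Y -> hacyclic X0 Y.
Proof.
move=> spl a1 a2 e F F0.
have [F' F'P] := hfam_splits_extend F ip spl.
have [a b|G GP] := hfam_extend (F := hdiff e F') ip.
  by rewrite -hdiff_comp (hdiff_ext _ F'P).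
have [a b|S SP] := a2 (~~ e) G.
  apply: (ses_epic (sip a)); rewrite -hdiff_comp (hdiff_ext _ GP) comp0m.
  by rewrite -{2}[e]negbK hdiff_hdiff.
have [a b|T TP] := a1 e (fun a b => F' a b - S a b \co cmap p a).
  by rewrite hdiffB hdiff_comp -GP SP negbK subrr.
exists (fun a b => T a b \co cmap i a) => a b.
rewrite hdiff_comp -TP compmBl F'P -compmA (ses_comp0 (sip a)).
by rewrite compm0 subr0.
Qed.

Lemma hacyclic_kernel_r Y :
  (forall a b, splits (cterm Y a) (cterm X0 b)) ->
  hacyclic Y X1 -> hacyclic Y X2 -> hacyclic Y X0.
Proof.
move=> spl a1 a2 e F F0.
have [a b|S SP] := a1 e (fun a b => cmap i b \co F a b).
  by rewrite comp_hdiff F0 compm0.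
have [a b|T TP] := a2 (~~ e) (fun a b => cmap p b \co S a b).
  by rewrite comp_hdiff -SP compmA (ses_comp0 (sip b)) comp0m.
have [T' T'P] := hfam_splits_lift T ip spl.
pose S' : hfam Y X1 := fun a b => S a b - hdiff (~~ ~~ e) T' a b.
have [a b|S'' S''P] := hfam_lift (F := S') ip.
  rewrite /S' compmBr TP -comp_hdiff.
  by rewrite (hdiff_ext (~~ ~~ e) (G := T)) ?subrr.
exists S'' => a b; apply: (ses_monic (sip b)); rewrite SP -comp_hdiff.
by rewrite (hdiff_ext _ S''P) hdiffB hdiff_hdiff subr0.
Qed.

End TwoOutOfThree.

(* The failure of degreewise sections to commute with the differentials is a
   cocycle of Hom(X, Y), so it can be corrected to zero. *)
Lemma ch_splits X Y :
  (forall m, splits (cterm X m) (cterm Y m)) -> hacyclic X Y -> splits X Y.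
Proof.
move=> spl ac E j p jp; have jpm := ch_ses_term abA jp.
have sH m : exists s, cmap p m \co s = idm _ by exact: spl _ _ _ _ (jpm m).
pose s m := sval (cid (sH m)).
have sP m : cmap p m \co s m = idm _ by rewrite /s; case: cid.
have [a b|F FP] := hfam_lift
    (F := fun a b => cdiff E a b \co s a - s b \co cdiff X a b) jp.
  rewrite compmBr !compmA -cmap_comm sP -compmA sP.
  by rewrite comp1m compm1 subrr.
have [a b|S SP] := ac false F.
  apply: (ses_monic (jpm b));
    rewrite compm0 -comp_hdiff (hdiff_ext _ FP) /hdiff.
  rewrite compmBr compmBl !compmA cdiff_cdiff comp0m sub0r -compmA.
  rewrite -(compmA (s b)) cdiff_cdiff compm0 subr0.
  (* The two remaining terms, both of the form d s d, cancel if a = b + 2; otherwise each vanishes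
     by shape. *)
  have [->|ab] := eqVneq (a - 1) (b + 1); first by rewrite compmA addNr.
  have ab' : a != b + 1 + 1 by apply: contraNneq ab => ->; rewrite addrK.
  rewrite (@cdiff_shape A X _ _ ab') !compm0 oppr0 add0r.
  by rewrite (@cdiff_shape A E (a - 1) b) // !comp0m.
have tP a b : cdiff E a b \co (s a - cmap j a \co S a a) =
    (s b - cmap j b \co S b b) \co cdiff X a b.
  have [->|ab] := eqVneq a (b + 1); last first.
    by rewrite !cdiff_shape // comp0m compm0.
  have := congr1 (fun u => cmap j b \co u) (SP (b + 1) b).
  rewrite FP /hdiff /= addrK compmBr => /eqP; rewrite subr_eq => /eqP e.
  rewrite compmBr e compmBl !compmA -cmap_comm.
  by rewrite [LHS]addrC -!addrA addKr addrC.
exists (ChainMap tP); apply: chain_mapP => m /=.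
by rewrite compmBr sP compmA (ses_comp0 (jpm m)) comp0m subr0.
Qed.

End HomComplex.

(** * Disc complexes and projective covers *)

Section Discs.
Variables (A : preadditive) (abA : abelian A).
Implicit Types C D : A -> Prop.

(** Identity maps indexed by pairs of degrees, as differentials are, so that terms in equal but not
    convertible degrees are related without casts. *)
Lemma graded_identity (G : int -> A) : exists id : forall i j, hom (G i) (G j),
  (forall i, id i i = idm (G i)) /\ (forall i j, i != j -> id i j = 0).
Proof.
have H i j : exists f : hom (G i) (G j),
    (forall e : i = j, f = ecast k (hom (G i) (G k)) e (idm (G i))) /\
    (i != j -> f = 0).
  have [ij|ij] := eqVneq i j; last first.
    by exists 0; split=> // e; rewrite e eqxx in ij.
  exists (ecast k (hom (G i) (G k)) ij (idm (G i))); split=> // e.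
  by rewrite (eq_irrelevance e ij).
exists (fun i j => sval (cid (H i j))); split=> [i|i j];
  case: cid => f /= [f1 f2].
  by rewrite (f1 erefl).
exact: f2.
Qed.

(** The differential squares to zero because p2 kills i1. When [theta] is invertible from degree j +
    1 to degree j, S is a sum of discs. *)
Lemma disc_exists (G H : int -> A) (theta : forall i j, hom (H i) (G j)) :
  (forall i j, i != j + 1 -> theta i j = 0) ->
  exists (S : Ch A) (i1 : forall m, hom (G m) (cterm S m))
    (i2 : forall m, hom (H m) (cterm S m)) (p1 : forall m, hom (cterm S m)
      (G m))
    (p2 : forall m, hom (cterm S m) (H m)),
    (forall m, is_biproduct (i1 m) (i2 m) (p1 m) (p2 m)) /\
    forall i j, cdiff S i j = i1 j \co theta i j \co p2 i.
Proof.
move=> theta0.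
have bP (m : int) : {s : A & {i1 : hom (G m) s & {i2 : hom (H m) s &
    {p1 : hom s (G m) & {p2 : hom s (H m) | is_biproduct i1 i2 p1 p2}}}}}.
  have /cid[s /cid[i1 /cid[i2 /cid[p1 /cid[p2 sP]]]]] :=
    abelian_biproduct abA (G m) (H m).
  by exists s, i1, i2, p1, p2.
pose s m := projT1 (bP m).
pose i1 m : hom (G m) (s m) := projT1 (projT2 (bP m)).
pose i2 m : hom (H m) (s m) := projT1 (projT2 (projT2 (bP m))).
pose p1 m : hom (s m) (G m) := projT1 (projT2 (projT2 (projT2 (bP m)))).
pose p2 m : hom (s m) (H m) := sval (projT2 (projT2 (projT2 (projT2 (bP m))))).
have sP m : is_biproduct (i1 m) (i2 m) (p1 m) (p2 m) :=
  svalP (projT2 (projT2 (projT2 (projT2 (bP m))))).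
pose d i j : hom (s i) (s j) := i1 j \co theta i j \co p2 i.
have dS i j : i != j + 1 -> d i j = 0.
  by move=> ij; rewrite /d theta0 // compm0 comp0m.
have dd i j k : d j k \co d i j = 0.
  rewrite /d -!compmA (compmA (p2 j)); have [_ _ -> _ _] := sP j.
  by rewrite comp0m !compm0.
by exists (Complex dS dd), i1, i2, p1, p2.
Qed.

Section Disc.
Variables (G H : int -> A) (theta : forall i j, hom (H i) (G j)) (S : Ch A).
Variables (i1 : forall m, hom (G m) (cterm S m)) (i2 : forall m, hom (H m)
  (cterm S m)).
Variables (p1 : forall m, hom (cterm S m) (G m))
  (p2 : forall m, hom (cterm S m) (H m)).
Hypothesis SP : forall m, is_biproduct (i1 m) (i2 m) (p1 m) (p2 m).
Hypothesis dS : forall i j, cdiff S i j = i1 j \co theta i j \co p2 i.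
Hypothesis thetaP : forall i j, i = j + 1 -> is_iso (theta i j).

Lemma disc_cycles m : is_kernel (i1 m) (cdiff S m (m - 1)).
Proof.
rewrite dS; apply: kernel_monic_comp (biproduct_ses (SP m)).1.
apply: monic_comp; first exact: ses_monic (biproduct_ses (SP _)).
by apply: iso_monic; apply: thetaP; rewrite subrK.
Qed.

Lemma disc_tilde C : (forall m, C (G m)) -> tilde C S.
Proof.
move=> CG; split=> m; last first.
  by exists (G m); split=> //; exists (i1 m); exact: disc_cycles.
apply/(exact_atE abA); exists (G m), (i1 m), (theta (m + 1) m \co p2 (m + 1)).
split; [exact: disc_cycles | | by rewrite dS compmA].
apply: epic_comp; first by apply: iso_epic; exact: thetaP.
exact: ses_epic (biproduct_ses (SP _)).
Qed.

End Disc.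

(* The free complex on the graded object [V]. *)
Lemma disc_generator (V : int -> A) :
  exists (S : Ch A) (i1 : forall m, hom (V (m + 1)) (cterm S m))
    (i2 : forall m, hom (V m) (cterm S m))
    (p1 : forall m, hom (cterm S m) (V (m + 1)))
    (p2 : forall m, hom (cterm S m) (V m)),
  [/\ forall m, is_biproduct (i1 m) (i2 m) (p1 m) (p2 m),
      forall C, (forall m, C (V m)) -> tilde C S,
      contractible S,
      forall (y : Ch A) (g : forall m, hom (V m) (cterm y m)),
        exists U : hom S y, forall m, cmap U m =
          cdiff y (m + 1) m \co g (m + 1) \co p1 m + g m \co p2 m
    & forall (y : Ch A) (f : hom S y) m, cmap f m =
        cdiff y (m + 1) m \co (cmap f (m + 1) \co i2 (m + 1)) \co p1 m
        + cmap f m \co i2 m \co p2 m].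
Proof.
have [id [id1 id0]] := graded_identity V.
have [|S [i1 [i2 [p1 [p2 [SP dS]]]]]] :=
    disc_exists (G := fun m => V (m + 1)) (H := V)
      (theta := fun i j => id i (j + 1)).
  by move=> i j; exact: id0.
exists S, i1, i2, p1, p2; split=> //.
- by move=> C CV; apply: (disc_tilde SP dS) => // i j ->; rewrite id1;
    exact: idm_iso.
(* The homotopy sends the copy of [V (i + 1)] in degree i back to the generators in degree i + 1. *)
- exists (fun i j => i2 j \co id (i + 1) j \co p1 i) => i.
  have [e1 e2 e3 e4 e5] := SP i.
  have [f1 f2 _ _ _] := SP (i + 1).
  have [g1 _ _ _ _] := SP (i - 1).
  rewrite !dS !id1 !compm1 !compmA -(compmA _ (p2 (i + 1))) f2 compm1.
  rewrite -(compmA _ (p1 (i - 1))) g1 compm1 -(compmA (i2 i)).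
  have -> : id (i - 1 + 1) i \co id i (i - 1 + 1) = idm (V i).
    by rewrite subrK id1 comp1m.
  by rewrite compm1.
- move=> y g.
  have UC i j : cdiff y i j \co
        (cdiff y (i + 1) i \co g (i + 1) \co p1 i + g i \co p2 i) =
      (cdiff y (j + 1) j \co g (j + 1) \co p1 j + g j \co p2 j) \co cdiff S i j.
    have [e1 e2 e3 e4 e5] := SP j.
    rewrite dS compmDl compmDr !compmA cdiff_cdiff !comp0m add0r.
    rewrite -(compmA (g j)) e3 compm0 !comp0m addr0 -(compmA _ (p1 j)) e1
      compm1.
    have [->|ij] := eqVneq i (j + 1); first by rewrite id1 compm1.
    by rewrite id0 // cdiff_shape // compm0 !comp0m.
  by exists (ChainMap UC).
- move=> z f m; rewrite -[LHS]compm1; have [_ _ _ _ <-] := SP m.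
  rewrite compmDr !compmA cmap_comm dS id1 compm1 !compmA -(compmA _ (p2 (m +
    1))).
  by have [_ -> _ _ _] := SP (m + 1); rewrite compm1.
Qed.

(** The free complex on degreewise covers. Freeness turns degreewise lifts into chain maps. For
    syzygies, contractibility preserves acyclicity of Hom, and projective terms preserve the
    degreewise vanishing of Ext. *)
Lemma ch_projective_cover (x : Ch A) : enough_projectives A ->
  exists (k S : Ch A) (i : hom k S) (p : hom S x),
    [/\ ses i p, projective S, contractible S
      & forall m, projective (cterm S m)].
Proof.
move=> epA.
have /cid[P /cid[e H]] : exists P : int -> A,
    exists e : forall m, hom (P m) (cterm x m),
    forall m, projective (P m) /\ epic (e m).
  exists (fun m => sval (cid (epA (cterm x m)))).
  exists (fun m => sval (cid (svalP (cid (epA (cterm x m)))))) => m.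
  by case: cid => q /= qP; case: cid.
have [S [i1 [i2 [p1 [p2 [SP _ cS SU Sf]]]]]] := disc_generator P.
have [p pE] := SU x e.
have [k [i ip]] : exists k (i : hom k S), ses i p.
  apply: (epic_ses (ch_abelian abA)); apply: ch_epic_by_term => m.
  apply: (@epic_compr _ _ _ _ _ (i2 m)); rewrite pE compmDl.
  have [_ e2 _ e4 _] := SP m.
  by rewrite -!compmA e2 e4 !compm0 compm1 add0r; exact: (H m).2.
exists k, S, i, p; split=> //.
- move=> u v q f /(ch_epic abA) eq.
  have lP m : exists h, cmap q m \co h = cmap f m \co i2 m.
    by apply: (H m).1; exact: eq.
  pose l m := sval (cid (lP m)).
  have qsl m : cmap q m \co l m = cmap f m \co i2 m by rewrite /l; case: cid.
  have [r rE] := SU u l; exists r; apply: chain_mapP => m.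
  rewrite [RHS]Sf [LHS]cmap_compE rE compmDr !compmA -cmap_comm qsl.
  by rewrite -(compmA _ (cmap q _)) qsl !compmA.
- move=> m u v q f eq.
  have [h1 h1P] := (H (m + 1)).1 _ _ q (f \co i1 m) eq.
  have [h2 h2P] := (H m).1 _ _ q (f \co i2 m) eq.
  exists (h1 \co p1 m + h2 \co p2 m); rewrite compmDr !compmA h1P h2P -!compmA.
  by have [_ _ _ _ e5] := SP m; rewrite -compmDr e5 compm1.
Qed.

Lemma ch_enough_projectives : enough_projectives A -> enough_projectives (Ch A).
Proof.
move=> epA x; have [k [S [i [p [ip SP _ _]]]]] := ch_projective_cover x epA.
by exists S, p; split=> //; exact: ses_epic ip.
Qed.

Lemma ch_ext_all (epA : enough_projectives A) (x y : Ch A) :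
  (forall i j, ext_all (cterm x i) (cterm y j)) -> hacyclic x y -> ext_all x y.
Proof.
move=> xy ac n; have abC := ch_abelian abA.
have epC := ch_enough_projectives epA.
have spl (x' : Ch A) : (forall i j, ext_all (cterm x' i) (cterm y j)) ->
    forall a b, splits (cterm x' a) (cterm y b).
  by move=> H a b; exact: (ext_all_splits abA epA).
elim: n x xy ac => [|n IH] x xy ac.
  by apply/(ext_zero1E abC epC)/ch_splits => // m; exact: spl.
have [k [S [i [p [ip SP cS Sm]]]]] := ch_projective_cover x epA.
apply/(ext_zeroS abC epC _ _ ip SP); apply: IH.
  by move=> a b; exact: (ext_all_syzygy abA epA (ch_ses_term abA ip a)).
apply: (hacyclic_kernel_l abA ip (spl _ xy)) ac.
exact: contractible_hacyclic_l.
Qed.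

End Discs.

(** * Exact complexes with cycles in a class *)

Section Tilde.
Variables (A : preadditive) (abA : abelian A).
Implicit Types C D : A -> Prop.

Lemma kernel_monic_cancel k (x y z : A) (i : hom k x) (f : hom x y)
    (m : hom y z) : monic m -> is_kernel i (m \co f) -> is_kernel i f.
Proof.
move=> mm iP; apply: kernelI; last 1 first.
- by move=> w g fg; apply: (kernel_lift iP); rewrite -compmA fg compm0.
- by apply: (monic_eq0 mm); rewrite compmA; exact: kernel_comp0 iP.
- exact: kernel_monic iP.
Qed.

Lemma exact_at_epic (x y z k : A) (f : hom x y) (g : hom y z) (i : hom k y)
    (q : hom x k) : exact_at f g -> is_kernel i g -> i \co q = f -> epic q.
Proof.
move=> /(exact_atE abA)[k' [i' [e [i'P ee ie]]]] iP iq.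
have [u [ui uP]] := kernel_iso iP i'P.
have <- : u \co e = q.
  by apply: (kernel_monic iP); rewrite compmA uP ie iq.
by apply: epic_comp ee; exact: iso_epic.
Qed.

(** The sequences z_m -> X_m -> z_(m-1) split, so X is a sum of discs. The contraction projects X_m
    to z_m by r and lifts it to X_(m+1) by s. *)
Lemma tilde_decomposition C (X : Ch A) :
  tilde C X -> (forall c d, C c -> C d -> splits c d) ->
  contractible X /\ forall m, exists c d (i1 : hom c (cterm X m))
    (i2 : hom d (cterm X m)) (p1 : hom (cterm X m) c) (p2 : hom (cterm X m) d),
    [/\ is_biproduct i1 i2 p1 p2, C c & C d].
Proof.
move=> [xX cX] spl.
have /cid[z /cid[iota H]] : exists (z : int -> A)
    (iota : forall m, hom (z m) (cterm X m)),
    forall m, is_kernel (iota m) (cdiff X m (m - 1)) /\ C (z m).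
  have H m : exists z (iota : hom z (cterm X m)),
      is_kernel iota (cdiff X m (m - 1)) /\ C z.
    by have [z [[i iP] Cz]] := cX m; exists z, i.
  exists (fun m => sval (cid (H m))).
  exists (fun m => sval (cid (svalP (cid (H m))))) => m.
  by case: cid => ? /= ?; case: cid.
have iP m := (H m).1; have Cz m := (H m).2; have mi m := kernel_monic (iP m).
have qH a b : exists q, iota b \co q = cdiff X a b.
  by apply: (kernel_lift (iP b)); rewrite cdiff_cdiff.
pose q a b := sval (cid (qH a b)).
have qP a b : iota b \co q a b = cdiff X a b by rewrite /q; case: cid.
have qi a : q a (a - 1) \co iota a = 0.
  by apply: (monic_eq0 (mi (a - 1))); rewrite compmA qP (kernel_comp0 (iP a)).
have qses a : ses (iota a) (q a (a - 1)).
  have ki : is_kernel (iota a) (q a (a - 1)).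
    by apply: (kernel_monic_cancel (mi (a - 1))); rewrite qP.
  split=> //; apply: (epic_cokernel_kernel abA _ ki).
  have := xX (a - 1); rewrite subrK => xa.
  exact: (exact_at_epic xa (iP _) (qP _ _)).
(* Only b = a + 1 matters; the second index and the default 0 avoid a cast between a and a + 1 -
   1. *)
have sH a b : exists s : hom (z a) (cterm X b),
    b = a + 1 -> q b a \co s = idm (z a).
  have [->|ab] := eqVneq b (a + 1); last by exists 0 => e; rewrite e eqxx in ab.
  have [s] : exists s, q (a + 1) (a + 1 - 1) \co s = idm (z (a + 1 - 1)).
    by apply: spl (qses (a + 1)); exact: Cz.
  by move: s; rewrite addrK => s sP; exists s.
pose s a b := sval (cid (sH a b)).
have sP a : q a (a - 1) \co s (a - 1) a = idm _.
  by rewrite /s; case: cid => /= t; apply; rewrite subrK.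
have sP' a : q (a + 1) a \co s a (a + 1) = idm _.
  by rewrite /s; case: cid => /= t; apply.
have rH a : exists r, iota a \co r = idm _ - s (a - 1) a \co q a (a - 1).
  apply: (ses_lift (qses a)).
  by rewrite compmBr compmA sP comp1m compm1 subrr.
pose r a := sval (cid (rH a)).
have rP a : iota a \co r a = idm _ - s (a - 1) a \co q a (a - 1).
  by rewrite /r; case: cid.
have ri a : r a \co iota a = idm _.
  by apply: mi; rewrite compmA rP compmBl -compmA qi compm0 comp1m compm1 subr0.
have rs a : r a \co s (a - 1) a = 0.
  by apply: (monic_eq0 (mi a));
    rewrite compmA rP compmBl -compmA sP comp1m compm1 subrr.
split.
  exists (fun a b => s a b \co r a) => a.
  rewrite -(qP a (a - 1)) -(qP (a + 1) a) !compmA -(compmA (iota a)) sP' compm1.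
  by rewrite -(compmA (s (a - 1) a)) ri compm1 rP subrK.
move=> m; exists (z m), (z (m - 1)), (iota m), (s (m - 1) m), (r m), (q m (m -
  1)).
split; [split=> // | exact: Cz | exact: Cz].
by rewrite rP subrK.
Qed.

Lemma biproduct_coproduct C (x y s : A) (i1 : hom x s) (i2 : hom y s)
    (p1 : hom s x) (p2 : hom s y) :
  fin_coproduct_closed C -> is_biproduct i1 i2 p1 p2 -> C x -> C y -> C s.
Proof.
move=> fC [e1 e2 e3 e4 e5] Cx Cy.
pose X (j : 'I_2) := if nat_of_ord j is 0 then x else y.
pose i (j : 'I_2) : hom (X j) s :=
  match nat_of_ord j as n return hom (if n is 0 then x else y) s with
  | 0 => i1 | _ => i2 end.
apply: (fC 2%N X s i); last by case=> -[|m] ?.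
move=> w f; pose f1 : hom x w := f (@Ordinal 2 0 isT).
pose f2 : hom y w := f (@Ordinal 2 1 isT).
have all2 (P : 'I_2 -> Prop) : P (@Ordinal 2 0 isT) -> P (@Ordinal 2 1 isT) ->
    forall j, P j.
  move=> P0 P1 [[|[|//]] lt].
    by rewrite (bool_irrelevance lt isT).
  by rewrite (bool_irrelevance lt isT).
exists (f1 \co p1 + f2 \co p2); split.
  apply: all2; rewrite /i /= compmDl -!compmA.
    by rewrite e1 e3 compm1 compm0 addr0.
  by rewrite e2 e4 compm1 compm0 add0r.
move=> h hP; have h1 : h \co i1 = f1 := hP (@Ordinal 2 0 isT).
have h2 : h \co i2 = f2 := hP (@Ordinal 2 1 isT).
by rewrite -h1 -h2 -!compmA -compmDr e5 compm1.
Qed.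

Lemma tilde_contractible C (X : Ch A) :
  (forall c d, C c -> C d -> splits c d) -> tilde C X -> contractible X.
Proof. by move=> spl CX; case: (tilde_decomposition CX spl). Qed.

Lemma tilde_terms C (X : Ch A) :
  (forall c d, C c -> C d -> splits c d) -> fin_coproduct_closed C ->
  tilde C X -> ChC C X.
Proof.
move=> spl fC CX m; have [_ H] := tilde_decomposition CX spl.
have [c [d [i1 [i2 [p1 [p2 [sP Cc Cd]]]]]]] := H m.
exact: biproduct_coproduct fC sP Cc Cd.
Qed.

End Tilde.

(** * Generators, cogenerators and finite resolutions of complexes *)

Section ChClasses.
Variables (A : preadditive) (abA : abelian A).
Let abC := ch_abelian abA.
Implicit Types C D V W X Y : A -> Prop.

Lemma ChC_pointed C : pointed C -> pointed (ChC C).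
Proof.
move=> [z [[zt zi] Cz]].
have dd (i j k : int) : (0 : hom z z) \co (0 : hom z z) = 0 by rewrite comp0m.
exists (@Complex A (fun=> z) (fun _ _ => 0) (fun _ _ _ => erefl) dd).
by split=> //; split=> X f; apply: chain_mapP => m; [exact: zt | exact: zi].
Qed.

Lemma ChC_extension_closed C : extension_closed C -> extension_closed (ChC C).
Proof.
move=> eC x y z f g /(short_exactE abC) fg Cx Cz m.
by apply: eC (Cx m) (Cz m); exact/(short_exactE abA)/(ch_ses_term abA fg m).
Qed.

(** Covers of the terms [y m] by [v m] extend to a chain map from the free complex on v. In degree m
    its kernel is a pullback of [g m] along a map from [v (m + 1)], hence an extension of
    [v (m + 1)] by [k m], which lies in Y. *)
Lemma ChC_rel_generator V Y :
  rel_generator V Y -> extension_closed Y -> subclass (tilde V) (ChC Y) ->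
  rel_generator (tilde V) (ChC Y).
Proof.
move=> [VY gen] eY VYt; split=> // y Yy.
have bP (m : int) : {v : A & {k : A & {f : hom k v & {g : hom v (cterm y m) |
    [/\ ses f g, V v & Y k]}}}}.
  have /cid[v /cid[k /cid[f /cid[g [fg Vv Yk]]]]] := gen _ (Yy m).
  by exists v, k, f, g; split=> //; exact/(short_exactE abA).
pose v m := projT1 (bP m); pose k m := projT1 (projT2 (bP m)).
pose f m : hom (k m) (v m) := projT1 (projT2 (projT2 (bP m))).
pose g m : hom (v m) (cterm y m) := sval (projT2 (projT2 (projT2 (bP m)))).
have H m : [/\ ses (f m) (g m), V (v m) & Y (k m)] :=
  svalP (projT2 (projT2 (projT2 (bP m)))).
have [S [i1 [i2 [p1 [p2 [SP SV _ SU _]]]]]] := disc_generator abA v.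
have [U UE] := SU y g.
have [K [i iU]] : exists K (i : hom K S), ses i U.
  apply: (epic_ses abC); apply: ch_epic_by_term => m.
  apply: (@epic_compr _ _ _ _ _ (i2 m)); rewrite UE compmDl.
  have [_ e2 _ e4 _] := SP m; have [fg _ _] := H m.
  by rewrite -!compmA e2 e4 !compm0 compm1 add0r; exact: ses_epic fg.
exists S, K, i, U; split; [exact/(short_exactE abC) | |].
  by apply: SV => m; case: (H m).
move=> m; have [fg _ Yk] := H m; have [_ Vv1 _] := H (m + 1).
(* The sign turns the sum defining U into the difference whose kernel is a pullback. *)
pose u := - (cdiff y (m + 1) m \co g (m + 1)).
have sP : @is_biproduct (opc A) _ _ _ (p2 m) (p1 m) (i2 m) (i1 m).
  by have [e1 e2 e3 e4 e5] := SP m; split=> //; rewrite addrC.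
have iP : is_kernel (cmap i m) (g m \co p2 m - u \co p1 m).
  rewrite compNm opprK addrC -UE; exact: (ch_ses_term abA iU m).1.
have po := @cokernel_pushout (opc A) _ _ _ _ _ (g m) u _ _ _ _ (cmap i m) sP iP.
have [q [_ [qs sq]]] := ses_pushout (op_abelian abA) (op_ses fg) po.
apply: eY Yk (VY _ Vv1); apply/(short_exactE abA); split;
  [exact: sq | exact: qs].
Qed.

(** Passing to the opposite of [Ch A] would reverse degrees, so the cofree complex, with terms w_m +
    w_(m-1), is written out. The cokernel in degree m is a pushout, hence an extension of [c m] by
    [w (m - 1)]. *)
Lemma ChC_rel_cogenerator W X :
  rel_cogenerator W X -> extension_closed X -> subclass (tilde W) (ChC X) ->
  rel_cogenerator (tilde W) (ChC X).
Proof.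
move=> [WX gen] eX WXt; split=> // x Xx.
have bP (m : int) : {w : A & {c : A & {f : hom (cterm x m) w & {g : hom w c |
    [/\ ses f g, W w & X c]}}}}.
  have /cid[w /cid[c /cid[f /cid[g [fg Ww Xc]]]]] := gen _ (Xx m).
  by exists w, c, f, g; split=> //; exact/(short_exactE abA).
pose w m := projT1 (bP m); pose c m := projT1 (projT2 (bP m)).
pose f m : hom (cterm x m) (w m) := projT1 (projT2 (projT2 (bP m))).
pose g m : hom (w m) (c m) := sval (projT2 (projT2 (projT2 (bP m)))).
have H m : [/\ ses (f m) (g m), W (w m) & X (c m)] :=
  svalP (projT2 (projT2 (projT2 (bP m)))).
have [id [id1 id0]] := graded_identity w.
have [|S [i1 [i2 [p1 [p2 [SP dS]]]]]] := disc_exists abA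
    (G := w) (H := fun m => w (m - 1)) (theta := fun i j => id (i - 1) j).
  by move=> i j ij; apply: id0; apply: contraNneq ij => <-; rewrite subrK.
have UC i j : cdiff S i j \co
      (i1 i \co f i + i2 i \co f (i - 1) \co cdiff x i (i - 1)) =
    (i1 j \co f j + i2 j \co f (j - 1) \co cdiff x j (j - 1)) \co cdiff x i j.
  have [e1 e2 e3 e4 e5] := SP i.
  rewrite dS compmDl compmDr -!compmA cdiff_cdiff !compm0 addr0.
  rewrite !compmA -(compmA _ (p2 i)) e3 compm0 comp0m add0r -(compmA _ (p2 i)).
  rewrite e2 compm1; have [->|ij] := eqVneq i (j + 1).
    by rewrite addrK id1 compm1.
  rewrite id0 ?(@cdiff_shape A x _ _ ij) ?compm0 ?comp0m //.
  by apply: contraNneq ij => <-; rewrite subrK.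
pose U : hom x S := ChainMap UC.
have UE m : cmap U m = i1 m \co f m + i2 m \co f (m - 1) \co cdiff x m (m - 1).
  by [].
have [K [q Uq]] : exists K (q : hom S K), ses U q.
  apply: (monic_ses abC); apply: ch_monic_by_term => m; rewrite UE.
  have [e1 _ _ e4 _] := SP m; have [fg _ _] := H m.
  apply: monicI => t h h0; apply: (monic_eq0 (ses_monic fg)).
  have := congr1 (fun l => p1 m \co l) h0.
  by rewrite compm0 compmA compmDr !compmA e1 e4 !comp0m comp1m addr0.
exists S, K, U, q; split; [exact/(short_exactE abC) | |].
  apply: (disc_tilde abA SP dS) => [i j ->|m]; last by case: (H m).
  by rewrite addrK id1; exact: idm_iso.
move=> m; have [fg _ Xc] := H m; have [_ Ww1 _] := H (m - 1).
pose u := - (f (m - 1) \co cdiff x m (m - 1)).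
have qP : is_cokernel (cmap q m) (i1 m \co f m - i2 m \co u).
  rewrite compmN opprK compmA -UE; exact: (ch_ses_term abA Uq m).2.
have po := cokernel_pushout (SP m) qP.
have [r [_ sr]] := ses_pushout abA fg po.
by apply: eX (WX _ Ww1) Xc; exact/(short_exactE abA)/sr.
Qed.

Lemma iwedge_ChC C (x : Ch A) m : iwedge (ChC C) x -> iwedge C (cterm x m).
Proof.
elim=> {x} [c x f fi Cc|k c x i p ip Cc _ IH].
  exact: iwedge_iso (ch_iso_term m fi) (Cc m).
exact: iwedge_ses (ch_ses_term abA ip m) (Cc m) IH.
Qed.

Lemma ivee_ChC C (x : Ch A) m : ivee (ChC C) x -> ivee C (cterm x m).
Proof.
elim=> {x} [c x f [g [gf fg]] Cc|k c x i p ip Cc _ IH].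
  have fi : @is_iso (Ch A) x c f by exists g.
  have [h [hf fh]] := ch_iso_term m fi.
  have fmi : @is_iso (opc A) _ _ (cmap (f : @hom (Ch A) x c) m) by exists h.
  exact: (iwedge_iso fmi (Cc m)).
have sm := ch_ses_term abA (op_ses ip) m.
exact: (iwedge_ses (op_ses sm) (Cc m) IH).
Qed.

Lemma iwedge_hacyclic (C : Ch A -> Prop) (x y : Ch A) :
  (forall w, C w -> contractible w) ->
  (forall x', iwedge C x' -> forall a b, splits (cterm x' a) (cterm y b)) ->
  iwedge C x -> hacyclic x y.
Proof.
move=> cC spl; elim=> {x} [c x f fi Cc|k c x i p ip Cc Ck IH].
  exact: contractible_hacyclic_l (contractible_iso fi (cC c Cc)).
apply: (hacyclic_cokernel_l abA ip _ IH).
  by apply: spl; exact: iwedge_ses ip Cc Ck.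
exact: contractible_hacyclic_l (cC c Cc).
Qed.

Lemma ivee_hacyclic (C : Ch A -> Prop) (x y : Ch A) :
  (forall v, C v -> contractible v) ->
  (forall y', ivee C y' -> forall a b, splits (cterm x a) (cterm y' b)) ->
  ivee C y -> hacyclic x y.
Proof.
move=> cC spl; elim=> {y} [c y f [g [gf fg]] Cc|k c y i p ip Cc Ck IH].
  have gi : @is_iso (Ch A) c y g by exists f.
  exact: contractible_hacyclic_r (contractible_iso gi (cC c Cc)).
apply: (hacyclic_kernel_r abA (op_ses ip) _ _ IH).
  by apply: spl; exact: iwedge_ses ip Cc Ck.
exact: contractible_hacyclic_r (cC c Cc).
Qed.

End ChClasses.

(** * The balanced system of complexes *)

Section ChSystem.
Variables (A : preadditive) (abA : abelian A) (epA : enough_projectives A).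
Let abC := ch_abelian abA.
Let epC := ch_enough_projectives abA epA.
Variables X W V Y : A -> Prop.
Hypotheses (fcW : fin_coproduct_closed W) (fcV : fin_coproduct_closed V).
Hypothesis XWVY : strong_finite_balanced_system X W V Y.

Lemma ch_strong_finite_balanced_system :
  strong_finite_balanced_system (ChC X) (tilde W) (tilde V) (ChC Y).
Proof.
case: XWVY => [[[pX eX] [pY eY] [WX XW] [VY YV] [XwV WwY] [WYv XVv]] YW XV].
have eall (C D : A -> Prop) : id_zero C D -> forall c d, C c -> D d ->
  ext_all c d.
  by move=> H c d Cc Dd n; exact: H.
have WW c d : W c -> W d -> splits c d.
  move=> Wc Wd; apply: (ext_all_splits abA epA).
  by apply: eall XW _ _ _ Wd; exact: WX.1.
have VV c d : V c -> V d -> splits c d.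
  move=> Vc Vd; apply: (ext_all_splits abA epA).
  by apply: eall YV _ _ Vc _; exact: VY.1.
have cW w : tilde W w -> contractible w by exact: tilde_contractible.
have cV v : tilde V v -> contractible v by exact: tilde_contractible.
have tW w : tilde W w -> ChC W w by exact: tilde_terms.
have tV v : tilde V v -> ChC V v by exact: tilde_terms.
have ext_l (C D : A -> Prop) (x y : Ch A) : id_zero C D -> contractible x ->
    ChC C x -> ChC D y -> ext_all x y.
  move=> CD cx Cx Dy; apply: (ch_ext_all abA epA).
    by move=> i j; exact: eall CD _ _ (Cx i) (Dy j).
  exact: contractible_hacyclic_l.
have ext_r (C D : A -> Prop) (x y : Ch A) : id_zero C D -> contractible y ->
    ChC C x -> ChC D y -> ext_all x y.
  move=> CD cy Cx Dy; apply: (ch_ext_all abA epA).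
    by move=> i j; exact: eall CD _ _ (Cx i) (Dy j).
  exact: contractible_hacyclic_r.
have iW (x : Ch A) m : iwedge (tilde W) x -> iwedge W (cterm x m).
  move=> Wx; apply: (iwedge_ChC abA).
  elim: Wx => {x} [c x f fi /tW Wc|k c x i p ip /tW Wc _ IH].
    exact: iwedge_iso fi Wc.
  exact: iwedge_ses ip Wc IH.
have iV (x : Ch A) m : ivee (tilde V) x -> ivee V (cterm x m).
  move=> Vx; apply: (ivee_ChC abA).
  elim: Vx => {x} [c x f fi /tV Vc|k c x i p ip /tV Vc _ IH].
    exact: (iwedge_iso fi Vc).
  exact: (iwedge_ses ip Vc IH).
split; first split.
- by split; [exact: ChC_pointed | exact: ChC_extension_closed].
- by split; [exact: ChC_pointed | exact: ChC_extension_closed].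
- split; first by apply: ChC_rel_cogenerator => // w /tW Ww m; exact: WX.1.
  by case=> // n _ x w Xx Ww; apply: ext_r XW _ Xx (tW _ Ww) n; exact: cW.
- split; first by apply: ChC_rel_generator => // v /tV Vv m; exact: VY.1.
  by case=> // n _ v y Vv Yy; apply: ext_l YV _ (tV _ Vv) Yy n; exact: cV.
(* In the first half y is contractible. In the second neither argument is known to be, and
   acyclicity of Hom(x, y) is carried along the finite resolution of x by contractible complexes. *)
- split=> x y.
    move=> /(iwedgeP abC) Xx Vy; apply/(ext_zero1E abC epC)/(ch_splits abA).
      move=> m; apply/(ext_zero1E abA epA)/XwV; last exact: tV.
      by apply/(iwedgeP abA); exact: iwedge_ChC.
    exact/contractible_hacyclic_r/cV.
  move=> /(iwedgeP abC) Wx Yy.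
  have spl x' : iwedge (tilde W) x' ->
    forall a b, splits (cterm x' a) (cterm y b).
    move=> Wx' a b; apply/(ext_zero1E abA epA)/WwY => //.
    by apply/(iwedgeP abA); exact: iW.
  apply/(ext_zero1E abC epC)/(ch_splits abA) => [m|]; first exact: spl.
  exact: iwedge_hacyclic cW spl Wx.
- split=> x y.
    move=> Wx /(iveeP abC) Yy; apply/(ext_zero1E abC epC)/(ch_splits abA).
      move=> m; apply/(ext_zero1E abA epA)/WYv; first exact: tW.
      by apply/(iveeP abA); exact: ivee_ChC.
    exact/contractible_hacyclic_l/cW.
  move=> Xx /(iveeP abC) Vy.
  have spl y' : ivee (tilde V) y' ->
    forall a b, splits (cterm x a) (cterm y' b).
    move=> Vy' a b; apply/(ext_zero1E abA epA)/XVv => //.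
    by apply/(iveeP abA); exact: iV.
  apply/(ext_zero1E abC epC)/(ch_splits abA) => [m|]; first exact: spl.
  exact: ivee_hacyclic cV spl Vy.
- by case=> // n _ w y Ww Yy; apply: ext_l YW _ (tW _ Ww) Yy n; exact: cW.
- by case=> // n _ x v Xx Vv; apply: ext_r XV _ Xx (tV _ Vv) n; exact: cV.
Qed.

End ChSystem.

Theorem proposition4p6 (A : preadditive) (X omega nu Y : A -> Prop) :
  abelian A -> enough_projectives A -> enough_injectives A ->
  iso_closed X -> iso_closed omega -> iso_closed nu -> iso_closed Y ->
  strong_finite_balanced_system X omega nu Y ->
  summand_closed X -> summand_closed Y ->
  fin_coproduct_closed omega -> fin_coproduct_closed nu ->
  strong_finite_balanced_system (ChC X) (tilde omega) (tilde nu) (ChC Y) /\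
  balanced_pair (ChC X) (ChC Y) (wedge (ChC X)) (vee (ChC Y)).
Proof.
move=> abA epA _ _ _ _ _ sys _ _ fcW fcV.
have chsys := ch_strong_finite_balanced_system abA epA fcW fcV sys.
split=> //; case: chsys => [fbs _ _].
exact: (finite_balanced_system_balanced_pair (ch_abelian abA)
  (ch_enough_projectives abA epA) fbs).
Qed.
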